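(* Let $n>1$ and $0\le\rho<n-1$, and let $v(\mathbf{z})$ be an admissible auxiliary controller for parameters $\alpha\ge0$, $\rho$, $T_f\in\mathbb{R}_+\cup\{\infty\}$ (with $\alpha>0$ if $T_f=\infty$). Assume that the origin of the auxiliary system $$\frac{\mathrm{d}\mathbf{z}}{\mathrm{d}\tau}=\mathbf{J}\mathbf{z}+\mathbf{b}_n(v(\mathbf{z})+\pi(\tau))$$ is uniformly Lyapunov stable. Let $T_c>0$ and consider the chain of integrators $\dot x_i=x_{i+1}$ ($i=1,\ldots,n-1$), $\dot x_n=u(\mathbf{x},t;T_c)+d(t)$, $|d(t)|\le\Delta$, in closed loop with the hybrid controller $u(\mathbf{x},t;T_c)=\phi(\mathbf{x},t;T_c)$ for $t\in[0,T_c)$ and $u(\mathbf{x},t;T_c)=w(\mathbf{x};\Delta)$ otherwise, where $$\phi(\mathbf{x},t;T_c)=\beta\kappa(t)^{n-\rho}\left[v\big(\beta^{-1}\mathbf{Q}_\rho\mathbf{K}_\rho^{-1}(t)\mathbf{x}\big)-\beta^{-1}\mathbf{b}_1^T(\mathbf{J}-\alpha\mathbf{D}_\rho)^n\mathbf{K}_\rho^{-1}(t)\mathbf{x}\right],$$ $$\kappa(t)=\frac{\eta}{\alpha(T_c-\eta t)},\qquad \eta=1-\exp(-\alpha T_f),\qquad \beta\ge(\alpha\eta^{-1}T_c)^{n-\rho}.$$ Then the origin of this closed-loop system is uniformly Lyapunov stable if and only if $\kappa(t)$ is uniformly bounded (on $[0,T_c)$).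
   Context: Notation: $\mathbb{R}_+=[0,\infty)$; $\exp(-\infty)=0$; $\mathbf{J}=[a_{ij}]\in\mathbb{R}^{n\times n}$ has $a_{ij}=1$ if $j=i+1$ and $a_{ij}=0$ otherwise; $\mathbf{b}_i\in\mathbb{R}^n$ is the vector with $1$ in entry $i$ and zeros elsewhere; $\mathbf{D}_\rho:=\mathrm{diag}\{-\rho,1-\rho,\ldots,n-1-\rho\}$; $\mathbf{Q}_\rho\in\mathbb{R}^{n\times n}$ is the matrix whose $k$-th row is $\mathbf{b}_1^T(\mathbf{J}-\alpha\mathbf{D}_\rho)^{k-1}$, $k=1,\ldots,n$; $\mathbf{K}_\rho(t):=\mathrm{diag}(\kappa(t)^{-\rho},\kappa(t)^{1-\rho},\ldots,\kappa(t)^{n-1-\rho})$. Expressions at $\alpha=0$ are understood as limits $\alpha\to0$ (e.g. $\kappa(t)=T_f/T_c$, $\alpha\eta^{-1}=1/T_f$). Solutions are understood in the sense of Filippov. $\Delta\ge0$ is a given constant. Uniform Lyapunov stability: the origin of the chain of integrators is uniformly Lyapunov stable if for every $\epsilon>0$ there exists $\delta>0$ such that for all $s\ge0$ and every admissible disturbance, $\|\mathbf{x}(s)\|\le\delta$ implies $\|\mathbf{x}(t)\|\le\epsilon$ for all $t\ge s$ (analogously for the auxiliary system, in $\tau$-time). Auxiliary system: its admissible disturbances are those $\pi$ with $|\pi(\tau)|\le\Delta\exp(-\alpha(n-\rho)\tau)$; its settling-time function is $\mathcal{T}(\mathbf{z}_0):=\inf\{\xi\ge0:\ \forall\text{ admissible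 }\pi,\ \lim_{\tau\to\xi}\mathbf{z}(\tau;\mathbf{z}_0,\pi)=0\}\in\mathbb{R}_+\cup\{\infty\}$. Admissible auxiliary controller: given $\alpha\ge0$, $\rho\in[0,n]$, $T_f\in\mathbb{R}_+\cup\{\infty\}$, $v(\mathbf{z})$ is an admissible auxiliary controller if (i) for every admissible disturbance $\pi$ the auxiliary system is asymptotically stable (at the origin), and $\sup_{\mathbf{z}_0\in\mathbb{R}^n}\mathcal{T}(\mathbf{z}_0)\le T_f$; and (ii) for every admissible disturbance $\pi$ (and every initial condition $\mathbf{z}_0$), $\lim_{\tau\to\infty}\exp(-\alpha(\rho+1-i)\tau)\,z_i(\tau;\mathbf{z}_0,\pi)=0$ for $i=1,\ldots,n$. Standing assumption: $w(\mathbf{x};\Delta)$ is a robust (sliding-mode) time-independent controller that maintains the chain of integrators at the origin in spite of any disturbance with $|d(t)|\le\Delta$, and it makes the origin of the chain of integrators stable. *)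

(* Defs.v *)
From HB Require Import structures.
From mathcomp Require Import all_boot all_order all_algebra.
From mathcomp Require Import all_classical all_reals all_analysis.
Set Implicit Arguments.
Unset Strict Implicit.
Unset Printing Implicit Defensive.
Import Order.TTheory GRing.Theory Num.Theory.
Import numFieldNormedType.Exports.
Local Open Scope classical_set_scope.
Local Open Scope ring_scope.

Section Filippov.
Context {R : realType} {n : nat}.
Local Notation vec := 'cV[R]_n.

(* The norm of the library on column vectors is the sup norm, so [ball c r] is
   an open cube of side [2 * r]. *)
Definition lebesgue_null (N : set vec) : Prop :=
  forall e : R, 0 < e ->
  exists c : nat -> vec, exists r : nat -> R,
    [/\ forall k, 0 <= r k,
        N `<=` \bigcup_k ball (c k) (r k) &
        (\sum_(0 <= k <oo) ((2 * r k) ^+ n)%:E <= e%:E)%E].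

Definition conv_hull (A : set vec) : set vec := smallest (@convex_set R vec) A.

Definition filippov_set (f : vec -> vec) (x : vec) : set vec :=
  \bigcap_(r in [set r : R | 0 < r]) \bigcap_(N in lebesgue_null)
    closure (conv_hull (f @` (ball x r `\` N))).

Definition abs_continuous (a b : R) (x : R -> vec) : Prop :=
  forall e : R, 0 < e -> exists2 d : R, 0 < d &
  forall (m : nat) (p q : 'I_m -> R),
    (forall i, a <= p i /\ p i <= q i /\ q i <= b) ->
    trivIset setT (fun i => `]p i, q i[%classic) ->
    \sum_(i < m) (q i - p i) < d ->
    \sum_(i < m) `|x (q i) - x (p i)| < e.

(* Solution on [s, T[ of the initial value problem x' = f t x, x s = x0; the
   values of x outside [s, T[ are irrelevant. *)
Definition filippov_solution (f : R -> vec -> vec) (s : R) (T : \bar R)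
    (x0 : vec) (x : R -> vec) : Prop :=
  [/\ x s = x0,
      forall b : R, s <= b -> (b%:E < T)%E -> abs_continuous s b x &
      {ae lebesgue_measure, forall t : R, s < t -> (t%:E < T)%E ->
        exists2 y : vec, filippov_set (f t) (x t) y & is_derive t 1 x y}].

End Filippov.

Section Chain.
Context {R : realType} (n : nat).
Local Notation vec := 'cV[R]_n.

Definition Jmx : 'M[R]_n := \matrix_(i, j) (j == i.+1 :> nat)%:R.

(* One-based: [bvec i] has its 1 in the i-th entry, i = 1, ..., n. *)
Definition bvec (i : nat) : vec := \col_(j < n) (j.+1 == i)%:R.

Definition chain_field (u : vec -> R -> R) (d : R -> R) (t : R) (x : vec) :
    vec :=
  Jmx *m x + (u x t + d t) *: bvec n.

Definition chain_solution (u : vec -> R -> R) (d : R -> R) (s : R) (T : \bar R)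
    (x0 : vec) (x : R -> vec) : Prop :=
  filippov_solution (chain_field u d) s T x0 x.

(* Filippov solutions need not be unique: a solution from x0 at time s exists
   for all t >= s, and no solution, on whatever interval, leaves the e-ball. *)
Definition remains_within (u : vec -> R -> R) (d : R -> R) (s : R) (x0 : vec)
    (e : R) : Prop :=
  (exists x, chain_solution u d s +oo%E x0 x) /\
  (forall (T : \bar R) (x : R -> vec), chain_solution u d s T x0 x ->
    forall t : R, s <= t -> (t%:E < T)%E -> `|x t| <= e).

Definition uniformly_lyapunov_stable (adm : set (R -> R)) (u : vec -> R -> R) :
    Prop :=
  forall e : R, 0 < e -> exists2 del : R, 0 < del &
  forall (s : R) (d : R -> R) (x0 : vec),
    0 <= s -> adm d -> `|x0| <= del -> remains_within u d s x0 e.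

Definition asymptotically_stable (u : vec -> R -> R) (d : R -> R) : Prop :=
  forall s : R, 0 <= s ->
  (forall e : R, 0 < e -> exists2 del : R, 0 < del &
    forall x0 : vec, `|x0| <= del -> remains_within u d s x0 e) /\
  (exists2 r : R, 0 < r &
    forall (x0 : vec) (x : R -> vec), `|x0| <= r ->
      chain_solution u d s +oo%E x0 x -> x t @[t --> +oo] --> (0 : vec)).

End Chain.

Section Disturbances.
Context {R : realType}.

Definition disturbances (bound : R -> R) : set (R -> R) :=
  [set d : R -> R | measurable_fun (`[0, +oo[ : set R) d /\
           forall t : R, 0 <= t -> `|d t| <= bound t].

Definition plant_disturbances (Delta : R) : set (R -> R) :=
  disturbances (fun=> Delta).

Definition aux_disturbances (n : nat) (Delta alpha rho : R) : set (R -> R) :=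
  disturbances (fun tau => Delta * expR (- alpha * (n%:R - rho) * tau)).

End Disturbances.

Section AuxiliaryController.
Context {R : realType} (n : nat).
Local Notation vec := 'cV[R]_n.

Definition aux_solution (v : vec -> R) (dist : R -> R) (z0 : vec)
    (z : R -> vec) : Prop :=
  chain_solution (fun z _ => v z) dist 0 +oo%E z0 z.

Definition settling_time (Delta alpha rho : R) (v : vec -> R) (z0 : vec) :
    \bar R :=
  ereal_inf [set xi%:E | xi in [set xi : R | 0 <= xi /\
    forall (dist : R -> R) (z : R -> vec),
      aux_disturbances n Delta alpha rho dist -> aux_solution v dist z0 z ->
      z tau @[tau --> within [set tau | 0 <= tau] xi^'] --> (0 : vec)]].

(* The first clause is what makes the trajectories z(tau; z0, dist) of the
   other clauses meaningful. *)
Definition admissible_aux_controller (Delta alpha rho : R) (Tf : \bar R)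
    (v : vec -> R) : Prop :=
  [/\ forall (dist : R -> R) (z0 : vec),
        aux_disturbances n Delta alpha rho dist ->
        exists z, aux_solution v dist z0 z,
      forall dist : R -> R, aux_disturbances n Delta alpha rho dist ->
        asymptotically_stable (fun z _ => v z) dist,
      (ereal_sup (range (settling_time Delta alpha rho v)) <= Tf)%E &
      forall (dist : R -> R) (z0 : vec) (z : R -> vec),
        aux_disturbances n Delta alpha rho dist -> aux_solution v dist z0 z ->
        forall i : 'I_n,
          expR (- alpha * (rho + 1 - i.+1%:R) * tau) * z tau i ord0
            @[tau --> +oo] --> (0 : R)].

(* [remains_within ... 0 0]: the state is kept exactly at the origin. *)
Definition robust_controller (Delta : R) (w : vec -> R) : Prop :=
  (forall (s : R) (d : R -> R), 0 <= s -> plant_disturbances Delta d ->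
    remains_within (fun x _ => w x) d s 0 0) /\
  uniformly_lyapunov_stable (plant_disturbances Delta) (fun x _ => w x).

End AuxiliaryController.

Section HybridController.
Context {R : realType} (n : nat).
Local Notation vec := 'cV[R]_n.
Variables (alpha rho : R) (Tf : \bar R) (Tc : R).

Definition eta : R := 1 - fine (expeR (- (alpha%:E * Tf))%E).

(* At alpha = 0 (where Tf is finite), kappa and alpha / eta take their limits as
   alpha tends to 0. *)
Definition kappa (t : R) : R :=
  if alpha == 0 then fine Tf / Tc else eta / (alpha * (Tc - eta * t)).

Definition alpha_over_eta : R :=
  if alpha == 0 then (fine Tf)^-1 else alpha / eta.

Definition Dmx : 'M[R]_n := diag_mx (\row_i (i%:R - rho)).

(* Rows are numbered from 0, so the exponent k.-1 of row k becomes k. *)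
Definition Qmx : 'M[R]_n :=
  \matrix_(k < n) ((bvec n 1)^T *m (Jmx n - alpha *: Dmx) ^+ k).

Definition Kmx (t : R) : 'M[R]_n := diag_mx (\row_i (kappa t `^ (i%:R - rho))).

Definition phi (beta : R) (v : vec -> R) (x : vec) (t : R) : R :=
  beta * kappa t `^ (n%:R - rho) *
  (v (beta^-1 *: (Qmx *m invmx (Kmx t) *m x)) -
   beta^-1 * ((bvec n 1)^T *m (Jmx n - alpha *: Dmx) ^+ n
                *m invmx (Kmx t) *m x) ord0 ord0).

Definition hybrid_controller (beta : R) (v w : vec -> R) (x : vec) (t : R) : R :=
  if (0 <= t) && (t < Tc) then phi beta v x t else w x.

End HybridController.

(* Main.v *)
Require Import Defs.
From HB Require Import structures.
From mathcomp Require Import all_boot all_order all_algebra.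
From mathcomp Require Import all_classical all_reals all_analysis.
From mathcomp Require Import measurable_realfun ring lra zify.
Set Implicit Arguments.
Unset Strict Implicit.
Unset Printing Implicit Defensive.
Import Order.TTheory GRing.Theory Num.Theory.
Import numFieldNormedType.Exports.
Local Open Scope classical_set_scope.
Local Open Scope ring_scope.

(** Let [c0] be the value of kappa at time [0].  Then
    [kappa t = c0 / (1 - alpha * c0 * t)] also at [alpha = 0], and
    [alpha * c0 * Tc] is [eta], or [0] if [alpha = 0]; it never exceeds [1].
    So kappa is bounded on [0, Tc) exactly when [alpha * c0 * Tc < 1], and the
    two cases of the equivalence are [alpha * c0 * Tc < 1] (stability holds)
    and [alpha * c0 * Tc = 1] (stability fails).

    Both use the same correspondence.  Run the plant in the time [tau] with
    [dtau = kappa dt], and let [z = beta^-1 Q K^-1 x].  In these variables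
    [kappa = c0 * expR (alpha * tau)], so every entry of the change of
    coordinates is an exponential of an affine function of [tau], and the rows
    of [Q], which form a Krylov sequence, turn the linear part into a companion
    form whose last row phi cancels.  The plant under phi becomes the auxiliary
    system with the disturbance [beta^-1 kappa^(rho - n) d], and the lower
    bound on [beta] is what makes this disturbance admissible
    ([aux_dist_admissible]).  Solutions are Filippov solutions, so the
    correspondence ([plant_to_aux], [aux_to_plant]) needs three facts: a linear
    map carries Filippov sets to Filippov sets and the perturbation by a
    continuous term only shifts them ([filippov_set_affine]); an absolutely
    continuous curve stays so under Lipschitz changes of coordinates and of
    time; and a change of time whose speed is bounded below pulls null sets
    back to null sets ([negligible_preimage_expanding]).

    If [alpha * c0 * Tc < 1], then [tau] ranges over a bounded interval, on
    which the change of coordinates and its inverse are bounded.  Uniform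
    stability of the auxiliary system then bounds every solution before [Tc],
    by continuity the bound holds at [Tc], and from there on the controller
    [w], itself uniformly stable, takes over ([hybrid_stable]).  Existence of
    solutions comes from gluing a transported auxiliary solution to a solution
    under [w].

    If [alpha * c0 * Tc = 1], then [tau] runs to infinity as [t] tends to [Tc],
    and clause (ii) of admissibility says that the first coordinate of [x]
    tends to [0] at [Tc].  A solution which starts at time [s] from [del] times
    the first basis vector therefore loses [del] in its first coordinate within
    the time [Tc - s], so its second coordinate, the velocity, must reach about
    [del / (Tc - s)].  As [s] tends to [Tc] this contradicts stability, for
    which [del] is uniform in [s] ([hybrid_unstable]).  For absolutely
    continuous curves this mean value argument is
    [abs_continuous_lipschitz]. *)

(** * Null sets of the line *)

Section null.
Context {R : realType}.
Local Notation mu := (@lebesgue_measure R).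
Local Notation l := (@wlength R idfun).

Global Instance ae_lebesgue_filter : Filter (nbhs (almost_everywhere mu)).
Proof. exact: (ae_filter_ringOfSetsType mu). Qed.

(** The constant is 2 because the interval used as a cover is centred at an
    arbitrary point of the set. *)
Lemma outer_measure_le_diam (A : set R) (c : R) : 0 <= c ->
  (forall x y, A x -> A y -> `|x - y| <= c) -> ((l^* A)%mu <= (2 * c)%:E)%E.
Proof.
move=> c0 Ac.
have [->|/set0P[x0 Ax0]] := eqVneq A set0.
  by rewrite outer_measure0 lee_fin mulr_ge0.
have AI : A `<=` `[x0 - c, x0 + c]%classic.
  move=> x Ax /=; rewrite in_itv/=.
  by have := Ac _ _ Ax Ax0; rewrite ler_distl => /andP[-> ->].
apply: le_trans (le_outer_measure (l^*)%mu _ _ AI) _.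
change (mu `[(x0 - c)%R, (x0 + c)%R]%classic <= (2 * c)%:E)%E.
rewrite lebesgue_measure_itv/=; case: ifPn => _; last by rewrite lee_fin mulr_ge0.
rewrite -EFinB lee_fin; lra.
Qed.

(** An interval of length [r] pulls back to a set of diameter at most
    [k * r], so a cover of [N] by intervals of small total length pulls back
    to a cover of the preimage of small total outer measure. *)
Lemma negligible_preimage_expanding (f : R -> R) (D N : set R) (k : R) : 0 < k ->
  (forall x y, D x -> D y -> `|x - y| <= k * `|f x - f y|) ->
  mu.-negligible N -> mu.-negligible (D `&` f @^-1` N).
Proof.
move=> k0 Df /negligible_outer_measure N0; apply/negligible_outer_measure.
apply/eqP; rewrite eq_le outer_measure_ge0 andbT; apply/lee_addgt0Pr => e e0.
rewrite add0e.
have e'0 : 0 < e / (2 * k) by rewrite divr_gt0// mulr_gt0.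
have [F NF Fe] : exists2 I_, open_itv_cover N I_ &
    (\sum_(0 <= k <oo) l (I_ k) <= (e / (2 * k))%:E)%E.
  have : ((l^* N)%mu \is a fin_num) by rewrite N0.
  move: N0; rewrite outer_measure_open_itv_cover => N0.
  move=> /lb_ereal_inf_adherent-/(_ _ e'0)[_/= [F]] AF <-; rewrite N0 add0e => Fe.
  by exists F => //; exact/ltW.
have sub : D `&` f @^-1` N `<=` \bigcup_i (D `&` f @^-1` (F i)).
  by move=> x [Dx /(NF.2)[i _ Fi]]; exists i.
apply: le_trans (le_outer_measure (l^*)%mu _ _ sub) _.
apply: le_trans (outer_measure_sigma_subadditive _ _) _.
apply: (@le_trans _ _ (\sum_(0 <= i <oo) (2 * k)%:E * l (F i))%E); last first.
  rewrite nneseriesZl; last by move=> i _; exact: wlength_ge0.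
  apply: (@le_trans _ _ ((2 * k)%:E * (e / (2 * k))%:E)%E).
    by rewrite lee_pmul2l// lte_fin mulr_gt0.
  by rewrite -EFinM lee_fin mulrC divfK// gt_eqF// mulr_gt0.
apply: lee_nneseries => [i _ _|i _]; first exact: outer_measure_ge0.
have [[a b] /= ->] := NF.1 i.
have [ab|ba] := ltP a b; last first.
  rewrite set_itv_ge ?bnd_simp -?leNgt// preimage_set0 setI0 outer_measure0.
  by rewrite wlength0 mule0.
rewrite wlength_itv/= lte_fin ab -EFinB -EFinM -mulrA.
apply: outer_measure_le_diam => [|x y [Dx]].
  by rewrite mulr_ge0// ?ltW// subr_gt0.
rewrite /= in_itv/= => /andP[ax xb] [Dy]; rewrite /= in_itv/= => /andP[ay yb].
apply: le_trans (Df _ _ Dx Dy) _; rewrite ler_pM2l//.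
rewrite ler_distl; lra.
Qed.

End null.

(** * Absolutely continuous curves with bounded derivative *)

Section mvt.
Context {R : realType} {m : nat}.
Local Notation mu := (@lebesgue_measure R).
Implicit Types (x : R -> 'cV[R]_m).

Lemma is_derive_le (x : R -> 'cV[R]_m) (t : R) (y : 'cV[R]_m) (e : R) : 0 < e ->
  is_derive t 1 x y ->
  exists2 r : R, 0 < r & forall u, `|u - t| < r ->
    `|x u - x t - (u - t) *: y| <= e * `|u - t|.
Proof.
move=> e0 [xt xty].
have := cvgP _ xt.
have : (fun h => h^-1 *: ((x \o shift t) (h *: 1) - x t)) @ 0^' --> y.
  by rewrite -xty; exact: xt.
move=> /cvgrPdist_le/(_ _ e0)[r/= r0 rP] _; exists r => // u utr.
have [->|ut] := eqVneq u t; first by rewrite !subrr scale0r subrr !normr0 mulr0.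
have h0 : u - t != 0 by rewrite subr_eq0.
have := rP (u - t); rewrite /ball/= sub0r normrN => /(_ utr h0).
rewrite /GRing.scale/= mulr1 subrK => /(ler_wpM2r (normr_ge0 (u - t))).
apply: le_trans; rewrite mulrC -normrZ scalerBr scalerA divff// scale1r.
by rewrite -normrN opprB.
Qed.

(** The mean value inequality, by a straddle argument.  Cover the exceptional
    set by an open [U] of small measure.  Around each point of [a, b] either
    short increments of [x] obey the bound up to [e], or short intervals lie in
    [U]; increments of the second kind are kept in a list of disjoint intervals
    of total length at most the measure of [U], so absolute continuity makes
    their sum small.  A supremum argument moves along [a, b]. *)
Lemma abs_continuous_lipschitz x (a b k : R) : 0 <= k -> a <= b ->
  abs_continuous a b x ->
  {ae mu, forall t, a < t -> t < b ->
     exists2 y, `|y| <= k & is_derive t 1 x y} ->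
  `|x b - x a| <= k * (b - a).
Proof.
move=> k0 ab acx aed.
suff H e : 0 < e -> `|x b - x a| <= (k + e) * (b - a) + e.
  apply/ler_addgt0Pr => e e0; rewrite -subr_ge0.
  have d0 : 0 < b - a + 1 by rewrite ltr_wpDl// subr_ge0.
  have := H (e / (b - a + 1)) (divr_gt0 e0 d0); rewrite -subr_ge0.
  congr (_ <= _); field; exact: lt0r_neq0.
move=> e0; have [d d0 dP] := acx _ e0.
pose bad := ~` [set t | a < t -> t < b ->
     exists2 y, `|y| <= k & is_derive t 1 x y] `|` [set a] `|` [set b].
have bad0 : mu.-negligible bad.
  apply: negligibleU; first apply: negligibleU.
  - exact: aed.
  - by apply/negligibleP => //; exact: lebesgue_measure_set1.
  - by apply/negligibleP => //; exact: lebesgue_measure_set1.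
have d20 : 0 < d / 2 by rewrite divr_gt0.
have [U [oU badU muU]] := outer_measure_open_le bad d20.
have {}muU : (mu U <= (d / 2)%:E)%E.
  by move: muU; rewrite (negligible_outer_measure bad).1// add0e.
have mU : measurable U by exact: open_measurable.
pose fam c (s : seq (R * R)) :=
  all (fun j => [&& a <= j.1, j.1 <= j.2 & j.2 <= c]) s &&
  pairwise (fun i j : R * R => j.2 <= i.1) s.
(* The list records, from the last to the first, the disjoint intervals on
   which the derivative bound is not available; they lie in [U]. *)
pose P c := exists s, [/\ fam c s,
  ((\sum_(j <- s) (j.2 - j.1))%:E <= mu (U `&` `[a, c]))%E &
  `|x c - x a| <= (k + e) * (c - a) + \sum_(j <- s) `|x j.2 - x j.1|].
have le_mu (A B : set R) : measurable A -> measurable B -> A `<=` B ->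
    (mu A <= mu B)%E.
  by move=> mA mB AB; apply: le_measure; rewrite ?inE.
have mI u v : measurable (U `&` `[u, v]%classic).
  by apply: measurableI => //; exact: measurable_itv.
have Pa : P a.
  exists [::]; split=> //; first by rewrite big_nil measure_ge0.
  by rewrite big_nil !subrr normr0 mulr0 addr0.
have step c c' : a <= c -> c <= c' -> P c ->
    `|x c' - x c| <= (k + e) * (c' - c) \/ `[c, c'] `<=` U -> P c'.
  move=> ac cc' [s [/andP[fs ps] ls xs]] alt.
  have fs' : all (fun j => [&& a <= j.1, j.1 <= j.2 & j.2 <= c']) s.
    apply: sub_all fs => j /and3P[-> -> jc]/=; exact: le_trans cc'.
  have xcc : `|x c' - x a| <= `|x c' - x c| + `|x c - x a|.
    by rewrite (le_trans _ (ler_normD _ _))// subrKA.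
  case: alt => alt.
  - exists s; split.
    + by rewrite /fam fs' ps.
    + apply: le_trans ls _; apply: le_mu (mI _ _) (mI _ _) _.
      apply: setIS => t/=; rewrite !in_itv/= => /andP[-> tc]/=.
      exact: le_trans cc'.
    + apply: le_trans xcc _; lra.
  - exists ((c, c') :: s); split.
    + rewrite /fam/= ac cc' lexx/= fs' ps andbT; apply/andP; split=> //.
      by apply: sub_all fs => j /and3P[].
    + rewrite big_cons/= EFinD addeC.
      apply: (@le_trans _ _ (mu (U `&` `[a, c]) + mu `]c, c'])%E).
        apply: leeD => //; rewrite lebesgue_measure_itv/= lte_fin.
        case: ltP => // c'c; rewrite lee_fin; lra.
      rewrite -measureU//; last first.
        apply/seteqP; split=> // t [[_ /=]]; rewrite !in_itv/=; lra.
        exact: mI.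
      apply: le_mu => //; first by apply: measurableU.
      have iE (u v w : R) : (`[u, v]%classic : set R) w = (u <= w <= v).
        by rewrite /= in_itv.
      move=> t [[Ut]|]; rewrite /setI/mkset !(iE, in_itv)/= => tc.
        by split=> //; lra.
      case/andP: tc => ct tc'; split; first by apply: alt; rewrite iE ltW.
      by rewrite tc' andbT (le_trans ac)// ltW.
    + apply: le_trans xcc _; rewrite big_cons/=.
      have : (k + e) * (c - a) <= (k + e) * (c' - a) by rewrite ler_wpM2l//; lra.
      by lra.
have straddle t : a <= t -> t <= b -> exists2 r, 0 < r &
    forall u v, u <= t -> t <= v -> t - r < u -> v < t + r ->
      `|x v - x u| <= (k + e) * (v - u) \/ `[u, v] `<=` U.
  move=> at_ tb; have [Ut|nUt] := pselect (U t).
    have /nbhs_ballP[r/= r0 rU] := open_nbhs_nbhs (conj oU Ut).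
    exists r => // u v ut tv tru vtr; right=> w/=; rewrite in_itv/= => uwv.
    apply: rU; rewrite /ball/= ltr_distlC; lra.
  have [/= ta' tb'] : a < t /\ t < b.
    split; rewrite lt_neqAle ?at_ ?tb andbT; apply/eqP => tE; apply: nUt;
      apply: badU; first by left; right.
    by right; rewrite /= tE.
  have [y yk xty] : exists2 y, `|y| <= k & is_derive t 1 x y.
    apply: contrapT => nd; apply: nUt; apply: badU; left; left => /= h.
    exact: nd (h ta' tb').
  have [r r0 rP] := is_derive_le e0 xty.
  exists r => // u v ut tv tru vtr; left.
  have xu : `|x u - x t - (u - t) *: y| <= e * (t - u).
    have h : `|u - t| = t - u by rewrite distrC ger0_norm// subr_ge0.
    by have := rP u; rewrite h; apply; lra.
  have xv : `|x v - x t - (v - t) *: y| <= e * (v - t).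
    have h : `|v - t| = v - t by rewrite ger0_norm// subr_ge0.
    by have := rP v; rewrite h; apply; lra.
  have -> : x v - x u = (x v - x t - (v - t) *: y) - (x u - x t - (u - t) *: y)
      + (v - u) *: y.
    have -> : (v - u) *: y = (v - t) *: y - (u - t) *: y.
      by rewrite -scalerBl; congr (_ *: _); ring.
    have E (A B P' Q : 'cV[R]_m) : A - P' - (B - Q) + (P' - Q) = A - B.
      by rewrite opprD opprK addrACA subrK addrK.
    by rewrite E opprB addrA subrK.
  have := ler_normD (x v - x t - (v - t) *: y - (x u - x t - (u - t) *: y))
    ((v - u) *: y).
  have := ler_normB (x v - x t - (v - t) *: y) (x u - x t - (u - t) *: y).
  have : `|(v - u) *: y| <= (v - u) * k.
    by rewrite normrZ ger0_norm ?ler_wpM2l//; lra.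
  lra.
pose S := [set c | a <= c <= b /\ P c].
have Sb : has_sup S.
  split; first by exists a; rewrite /S/= lexx ab.
  by exists b => c [/andP[]].
have Sa : S a by rewrite /S/= lexx ab.
have sa : a <= sup S by exact: ub_le_sup Sb.2 _ Sa.
have sb : sup S <= b by apply: ge_sup => //; [exact: Sb.1|move=> c [/andP[]]].
have [r r0 rP] := straddle _ sa sb.
have [c [/andP[ac cb] Pc] rc] := sup_adherent r0 Sb.
have cs : c <= sup S by apply: ub_le_sup Sb.2 _ _; rewrite /S/= ac cb.
pose v := Num.min b (sup S + r / 2).
have sv : sup S <= v by rewrite le_min sb/=; lra.
have vr : v < sup S + r by rewrite gt_min; apply/orP; right; lra.
have Pv : P v.
  apply: (step c) => //; first exact: le_trans sv.
  exact: rP.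
have vb : v = b.
  have vS : v <= sup S.
    apply: ub_le_sup Sb.2 _ _; split=> //; rewrite ge_min lexx andbT.
    exact: le_trans sv.
  move: vS; rewrite /v minEle; case: ifPn => // _; lra.
move: Pv; rewrite vb => -[s [/andP[/allP fs /(pairwiseP (0, 0)) ps] ls xs]].
apply: le_trans xs _; rewrite lerD2l; apply: ltW.
rewrite (big_nth (0, 0)) big_mkord.
apply: (dP (size s) (fun i => (nth (0, 0) s i).1) (fun i => (nth (0, 0) s i).2)).
- by move=> i; have /and3P[] := fs _ (mem_nth (0, 0) (ltn_ord i)).
- apply/trivIsetP => i j _ _ ij; apply/seteqP; split=> // t [/=].
  rewrite !in_itv/= => ti tj.
  have : (i < j)%N || (j < i)%N by rewrite -neq_ltn.
  by case/orP => /ps; rewrite !inE !ltn_ord => /(_ isT isT); lra.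
- rewrite -(big_mkord xpredT (fun i => (nth (0, 0) s i).2 - (nth (0, 0) s i).1)).
  rewrite -(big_nth _ xpredT (fun j : R * R => j.2 - j.1)) -lte_fin.
  apply: le_lt_trans ls _; apply: (@le_lt_trans _ _ (mu U)).
    by apply: le_mu => // t [].
  by apply: le_lt_trans muU _; rewrite lte_fin; lra.
Qed.
End mvt.

(** * Norms of matrices and absolute continuity *)

Section mulmx_norm.
Context {R : realType}.

Lemma mx_entry_norm m n (A : 'M[R]_(m, n)) i j : `|A i j| <= `|A|.
Proof.
rewrite [leRHS]/Num.Def.normr/= mx_normrE.
exact: (le_bigmax _ (fun ij : 'I_m * 'I_n => `|A ij.1 ij.2|) (i, j)).
Qed.

Lemma mx_norm_leP m n (A : 'M[R]_(m, n)) (c : R) : 0 <= c ->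
  (forall i j, `|A i j| <= c) -> `|A| <= c.
Proof.
move=> c0 Ac; rewrite [leLHS]/Num.Def.normr/= mx_normrE.
by apply: bigmax_le => // -[i j] _; exact: Ac.
Qed.

Lemma norm_scalar_mx1 (r : R) : `|r%:M : 'M[R]_1| = `|r|.
Proof.
apply/eqP; rewrite eq_le; apply/andP; split.
  by apply: mx_norm_leP => // i j; rewrite !ord1 !mxE eqxx mulr1n.
by apply: le_trans (mx_entry_norm _ ord0 ord0); rewrite !mxE eqxx mulr1n.
Qed.

Lemma mulmx_norm_le m n p (A : 'M[R]_(m, n)) (B : 'M[R]_(n, p)) :
  `|A *m B| <= n%:R * `|A| * `|B|.
Proof.
apply: mx_norm_leP => [|i j]; first by rewrite !mulr_ge0.
rewrite mxE (le_trans (ler_norm_sum _ _ _))//.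
have -> : n%:R * `|A| * `|B| = \sum_(k < n) `|A| * `|B|.
  by rewrite sumr_const card_ord -[RHS]mulr_natl mulrA.
by apply: ler_sum => k _; rewrite normrM ler_pM// mx_entry_norm.
Qed.

End mulmx_norm.

Section abs_continuous.
Context {R : realType}.

Lemma abs_continuousS n (a b a' b' : R) (x : R -> 'cV[R]_n) :
  a <= a' -> b' <= b -> abs_continuous a b x -> abs_continuous a' b' x.
Proof.
move=> aa' bb' acx e /acx[d d0 dP]; exists d => // m p q pq.
apply: dP => i; have [ap [pqi qb]] := pq i.
by split; [exact: le_trans ap|split=> //; exact: le_trans bb'].
Qed.

(** Two dominating curves are enough for sums, for products (the second one
    being time itself) and for gluing. *)
Lemma abs_continuous_dominated n n1 n2 (a b c : R) (y : R -> 'cV[R]_n)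
    (x1 : R -> 'cV[R]_n1) (x2 : R -> 'cV[R]_n2) : 0 <= c ->
  (forall p q, a <= p -> p <= q -> q <= b ->
    `|y q - y p| <= c * (`|x1 q - x1 p| + `|x2 q - x2 p|)) ->
  abs_continuous a b x1 -> abs_continuous a b x2 -> abs_continuous a b y.
Proof.
move=> c0 yx ac1 ac2 e e0.
have e'0 : 0 < e / 2 / (c + 1) by rewrite !divr_gt0// ltr_wpDl.
have [d1 d10 d1P] := ac1 _ e'0; have [d2 d20 d2P] := ac2 _ e'0.
exists (Num.min d1 d2); first by rewrite lt_min d10.
move=> m p q pq tpq; rewrite lt_min => /andP[pqd1 pqd2].
have := d1P _ _ _ pq tpq pqd1; have := d2P _ _ _ pq tpq pqd2.
set S2 := \sum_(i < m) _; set S1 := \sum_(i < m) _ => h2 h1.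
apply: (@le_lt_trans _ _ (c * (S1 + S2))).
  rewrite /S1 /S2 -big_split/= mulr_sumr; apply: ler_sum => i _.
  by have [? []] := pq i; exact: yx.
apply: (@le_lt_trans _ _ (c * (e / (c + 1)))).
  rewrite ler_wpM2l//; have -> : e / (c + 1) = e / 2 / (c + 1) + e / 2 / (c + 1).
    by rewrite -mulrDl -splitr.
  by rewrite lerD// ltW.
rewrite mulrA ltr_pdivrMr ?ltr_wpDl//; lra.
Qed.

Lemma abs_continuous_id (a b : R) : abs_continuous a b (fun t => t%:M : 'cV[R]_1).
Proof.
move=> e e0; exists e => // m p q pq _; apply: le_lt_trans.
apply: ler_sum => i _; have [_ [pqi _]] := pq i.
by rewrite -raddfB/= norm_scalar_mx1 ger0_norm// subr_ge0.
Qed.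

(** Monotonicity of [f] keeps disjoint intervals disjoint; the Lipschitz bound
    controls their total length. *)
Lemma abs_continuous_comp n (a b a' b' k : R) (x : R -> 'cV[R]_n) (f : R -> R) :
  0 <= k ->
  (forall p q, a <= p -> p <= q -> q <= b ->
    [/\ a' <= f p, f p <= f q, f q <= b' & f q - f p <= k * (q - p)]) ->
  abs_continuous a' b' x -> abs_continuous a b (x \o f).
Proof.
move=> k0 fP acx e e0; have [d d0 dP] := acx _ e0.
exists (d / (k + 1)); first by rewrite divr_gt0// ltr_wpDl.
move=> m p q pq tpq pqd; apply: (dP _ (f \o p) (f \o q)).
- by move=> i; have [? [? ?]] := pq i; have [] := fP (p i) (q i).
- apply/trivIsetP => i j _ _ ij; apply/seteqP; split=> // t [].
  rewrite /= !in_itv/= => /andP[pit tqi] /andP[pjt tqj].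
  wlog pij : i j ij pit tqi pjt tqj / p i <= p j.
    by move=> h; have [/h|/ltW/h] := leP (p i) (p j); apply; rewrite // eq_sym.
  have [? [? ?]] := pq i; have [? [? ?]] := pq j.
  have [qipj|pjqi] := leP (q i) (p j).
    have [_ + _ _] := fP (q i) (p j) ltac:(lra) qipj ltac:(lra).
    by move: pjt tqi => /lt_trans/[apply]; rewrite ltNge => /negP.
  have [pq'|] := ltP (p j) (q j); last first.
    move=> qp; have E : p j = q j by apply/eqP; rewrite eq_le qp andbT.
    by move: pjt; rewrite E => /lt_trans/(_ tqj); rewrite ltxx.
  have /trivIsetP/(_ i j I I ij)/seteqP[+ _] := tpq.
  move=> /(_ ((p j + Num.min (q i) (q j)) / 2)); apply.
  have h1 : p j < Num.min (q i) (q j) by rewrite lt_min pjqi.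
  have h2 : Num.min (q i) (q j) <= q i by rewrite ge_min lexx.
  have h3 : Num.min (q i) (q j) <= q j by rewrite ge_min lexx orbT.
  by split; rewrite /= in_itv/=; lra.
- apply: (@le_lt_trans _ _ (k * (d / (k + 1)))); last first.
    rewrite mulrA ltr_pdivrMr ?ltr_wpDl//; lra.
  apply: (@le_trans _ _ (k * \sum_(i < m) (q i - p i))); last first.
    by rewrite ler_wpM2l// ltW.
  rewrite mulr_sumr; apply: ler_sum => i _.
  by have [? [? ?]] := pq i; have [] := fP (p i) (q i).
Qed.

Lemma abs_continuous_dist n (a b : R) (x : R -> 'cV[R]_n) (e : R) : 0 < e ->
  abs_continuous a b x ->
  exists2 d, 0 < d & forall p q, a <= p -> p <= q -> q <= b -> q - p < d ->
    `|x q - x p| < e.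
Proof.
move=> e0 /(_ _ e0)[d d0 dP]; exists d => // p q ap pq qb qpd.
have := dP 1%N (fun=> p) (fun=> q); rewrite !big_ord_recl !big_ord0 !addr0.
by apply=> //; apply/trivIsetP => i j; rewrite !ord1 eqxx.
Qed.

(** Freezing [x] outside [a, b] gives a continuous function on the whole line,
    to which the extreme value theorem applies. *)
Lemma abs_continuous_bounded n (a b : R) (x : R -> 'cV[R]_n) : a <= b ->
  abs_continuous a b x ->
  exists2 c, 0 <= c & forall t, a <= t -> t <= b -> `|x t| <= c.
Proof.
move=> ab acx; pose clip t := Num.max a (Num.min t b).
have clipP t : a <= clip t <= b.
  by rewrite le_max lexx/= ge_max ab ge_min lexx orbT.
have clip_le s t : s <= t -> clip s <= clip t /\ clip t - clip s <= t - s.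
  rewrite /clip !maxEle !minEle => st.
  by do ?[case: ifP => //]; move=> *; lra.
have [|c cI cmax] := @EVT_max R (fun t => `|x (clip t)|) a b ab.
  apply: continuous_subspaceT => t; apply/cvgrPdist_lt => e e0.
  have [d d0 dP] := abs_continuous_dist e0 acx.
  apply/nbhs_ballP; exists d => //= s; rewrite /ball/= => ts.
  apply: le_lt_trans (ler_dist_dist _ _) _.
  wlog st : s t ts / s <= t.
    move=> h; have [st|/ltW ts'] := leP s t; first exact: h.
    by rewrite distrC; apply: h => //; rewrite distrC.
  have [h1 h2] := clip_le _ _ st; have /andP[? ?] := clipP s.
  have /andP[? ?] := clipP t; apply: dP => //.
  by apply: le_lt_trans h2 _; apply: le_lt_trans ts; rewrite ler_norm.
exists `|x (clip c)| => // t at_ tb.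
have := cmax t; rewrite in_itv/= at_ tb => /(_ isT).
by rewrite /clip (min_idPl tb) (max_idPr at_).
Qed.

Lemma abs_continuous_mulmx m n (a b k : R) (M : R -> 'M[R]_(m, n))
    (x : R -> 'cV[R]_n) : a <= b -> 0 <= k ->
  (forall p q, a <= p -> p <= q -> q <= b -> `|M q - M p| <= k * (q - p)) ->
  abs_continuous a b x -> abs_continuous a b (fun t => M t *m x t).
Proof.
move=> ab k0 Mk acx; have [B B0 xB] := abs_continuous_bounded ab acx.
pose C := `|M a| + k * (b - a).
have MC t : a <= t -> t <= b -> `|M t| <= C.
  move=> at_ tb; rewrite -(subrK (M a) (M t)) (le_trans (ler_normD _ _))//.
  rewrite addrC lerD2l (le_trans (Mk _ _ _ _ _))// ler_wpM2l//; lra.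
have C0 : 0 <= C by rewrite addr_ge0// mulr_ge0// subr_ge0.
apply: (@abs_continuous_dominated m n 1 a b (n%:R * C + n%:R * k * B) _ x
  (fun t => t%:M)).
- by rewrite addr_ge0// !mulr_ge0.
- move=> p q ap pq qb; have pb := le_trans pq qb; have aq := le_trans ap pq.
  have -> : M q *m x q - M p *m x p = M q *m (x q - x p) + (M q - M p) *m x p.
    by rewrite mulmxBr mulmxBl addrA subrK.
  have -> : `|(q%:M : 'cV[R]_1) - p%:M| = q - p.
    by rewrite -raddfB/= norm_scalar_mx1 ger0_norm// subr_ge0.
  apply: le_trans (ler_normD _ _) _.
  have h1 : `|M q *m (x q - x p)| <= n%:R * C * `|x q - x p|.
    by rewrite (le_trans (mulmx_norm_le _ _))// ler_wpM2r// ler_wpM2l// MC.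
  have h2 : `|(M q - M p) *m x p| <= n%:R * k * B * (q - p).
    rewrite (le_trans (mulmx_norm_le _ _))//.
    have -> : n%:R * k * B * (q - p) = n%:R * (k * (q - p)) * B by ring.
    by rewrite ler_pM ?mulr_ge0// ?ler_wpM2l ?Mk ?xB.
  have h3 : 0 <= n%:R * C * (q - p) by rewrite !mulr_ge0// subr_ge0.
  have h4 : 0 <= n%:R * k * B * `|x q - x p| by rewrite !mulr_ge0.
  lra.
- exact: acx.
- exact: abs_continuous_id.
Qed.

End abs_continuous.

(** * Affine images of Filippov sets *)

Section filippov_set.
Local Open Scope convex_scope.
Context {R : realType} {n : nat}.
Local Notation vec := 'cV[R]_n.
Implicit Types (f g : vec -> vec) (x y : vec).

Lemma convex_conv_hull (A : set vec) :
  convex_set (conv_hull A : set (convex_lmodType vec)).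
Proof.
move=> x y l; rewrite !inE => Ax Ay C CA.
have Cx := Ax C CA; have Cy := Ay C CA.
by apply/set_mem; apply: CA.1; apply/mem_set.
Qed.

(** The inverse of [P] is Lipschitz, so it maps a cube into a cube whose side is
    larger by a factor [L]; the volumes grow by [L ^+ n]. *)
Lemma lebesgue_null_mulmx (P : 'M[R]_n) (N : set vec) : P \in unitmx ->
  lebesgue_null N -> lebesgue_null [set x | N (P *m x)].
Proof.
move=> uP N0 e e0; pose L := n%:R * `|invmx P| + 1.
have L0 : 0 < L by rewrite ltr_wpDl// mulr_ge0.
have [c [r [r0 Nc cr]]] := N0 _ (divr_gt0 e0 (exprn_gt0 n L0)).
exists (fun k => invmx P *m c k), (fun k => L * r k); split.
- by move=> k; rewrite mulr_ge0// ltW.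
- move=> x /Nc[k _]; rewrite -!ball_normE/= => ckx; exists k => //=.
  have -> : invmx P *m c k - x = invmx P *m (c k - P *m x).
    by rewrite mulmxBr mulKmx.
  apply: le_lt_trans (mulmx_norm_le _ _) _.
  apply: (@le_lt_trans _ _ (n%:R * `|invmx P| * r k)).
    by rewrite ler_wpM2l ?mulr_ge0// ltW.
  by rewrite ltr_pM2r ?ltrDl//; exact: le_lt_trans ckx.
- rewrite (eq_eseriesr (g := fun k => (L ^+ n)%:E * ((2 * r k) ^+ n)%:E)%E).
    rewrite nneseriesZl; last first.
      by move=> k _; rewrite lee_fin exprn_ge0// mulr_ge0.
    apply: (@le_trans _ _ ((L ^+ n)%:E * (e / L ^+ n)%:E)%E).
      by rewrite lee_pmul2l// lte_fin exprn_gt0.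
    by rewrite -EFinM lee_fin mulrC divfK// gt_eqF// exprn_gt0.
  by move=> k _; rewrite -EFinM -exprMn; congr (_ ^+ _)%:E; ring.
Qed.

Lemma closure_ballP m (A : set 'cV[R]_m) (y : 'cV[R]_m) :
  (forall e : R, 0 < e -> exists2 w, A w & `|y - w| < e) <-> closure A y.
Proof.
split=> [Ay B /nbhs_ballP[e/= e0 eB]|Ay e e0].
  have [w Aw yw] := Ay _ e0; exists w; split=> //.
  by apply: eB; rewrite -ball_normE.
have [w [Aw]] := Ay _ (nbhsx_ballx y e e0).
by rewrite -ball_normE/= => yw; exists w.
Qed.

Lemma lebesgue_null0 : (0 < n)%N -> lebesgue_null (set0 : set vec).
Proof.
move=> n0 e e0; exists (fun=> 0), (fun=> 0); split=> //.
rewrite eseries0 ?lee_fin ?ltW// => k _ _.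
by rewrite mulr0 expr0n; case: n n0.
Qed.

(** The points [w] such that [B *m w + c] is [e]-close to the convex set [D] form
    a convex set.  It contains the values of [f] near [x] off a null set, hence
    their convex hull, and [y] is a limit of points of that hull. *)
Lemma filippov_set_approx m f x y (B : 'M[R]_(m, n)) (c : 'cV[R]_m)
    (D : set 'cV[R]_m) :
  convex_set (D : set (convex_lmodType 'cV[R]_m)) ->
  (forall e : R, 0 < e -> exists2 r : R, 0 < r & exists2 N, lebesgue_null N &
    forall x', ball x r x' -> ~ N x' ->
      exists2 u, D u & `|u - (B *m f x' + c)| <= e) ->
  filippov_set f x y -> closure D (B *m y + c).
Proof.
move=> cD near Fy; apply/closure_ballP => e e0.
have e20 : 0 < e / 2 by rewrite divr_gt0.
have [r r0 [N N0 rP]] := near _ e20.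
pose C : set vec := [set w | exists2 u, D u & `|u - (B *m w + c)| <= e / 2].
have cC : convex_set (C : set (convex_lmodType vec)).
  move=> w1 w2 l; rewrite !inE => -[u1 Du1 u1w1] [u2 Du2 u2w2].
  exists ((u1 : convex_lmodType 'cV[R]_m) <| l |> u2).
    by apply/set_mem; apply: cD; exact/mem_set.
  have cE k (v1 v2 : 'cV[R]_k) : (v1 : convex_lmodType 'cV[R]_k) <| l |> v2 =
     l%:num *: v1 + (1 - l%:num) *: v2 by [].
  have -> : (u1 : convex_lmodType 'cV[R]_m) <| l |> u2 -
      (B *m ((w1 : convex_lmodType vec) <| l |> w2) + c) =
      l%:num *: (u1 - (B *m w1 + c)) + (1 - l%:num) *: (u2 - (B *m w2 + c)).
    rewrite !cE mulmxDr -!scalemxAr; apply/matrixP => i j; rewrite !mxE; ring.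
  have l0 : 0 <= l%:num by [].
  have l1 : 0 <= 1 - l%:num by rewrite subr_ge0.
  apply: le_trans (ler_normD _ _) _; rewrite !normrZ !ger0_norm//.
  have := ler_wpM2l l0 u1w1; have := ler_wpM2l l1 u2w2; lra.
have b0 : 0 < n%:R * `|B| + 1 by rewrite ltr_wpDl// mulr_ge0.
have /closure_ballP/(_ _ (divr_gt0 e20 b0))[w [u Du uw] yw] : closure C y.
  apply: closure_subset (Fy r r0 N N0).
  by apply: smallest_sub => // _ [x' [xx' Nx'] <-]; exact: rP.
exists u => //.
have -> : B *m y + c - u = B *m (y - w) - (u - (B *m w + c)).
  by rewrite mulmxBr opprB addrACA; apply/matrixP => i j; rewrite !mxE; ring.
apply: le_lt_trans (ler_normB _ _) _.
suff : `|B *m (y - w)| < e / 2 by lra.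
apply: le_lt_trans (mulmx_norm_le _ _) _.
apply: (@le_lt_trans _ _ ((n%:R * `|B| + 1) * `|y - w|)).
  by rewrite ler_wpM2r// lerDl.
by rewrite mulrC -ltr_pdivlMr.
Qed.

(** The continuous term [h] is almost constant near [x], so it only shifts the
    Filippov set; [P] preserves null sets and neighbourhoods. *)
Lemma filippov_set_affine f g (P B : 'M[R]_n) (h : vec -> vec) x y :
  P \in unitmx -> {for x, continuous h} ->
  (forall x', g (P *m x') = B *m f x' + h x') ->
  filippov_set f x y -> filippov_set g (P *m x) (B *m y + h x).
Proof.
move=> uP hc gE Fy r/= r0 N N0.
apply: filippov_set_approx Fy => [|e e0]; first exact: convex_conv_hull.
move/cvgrPdist_le : hc => /(_ _ e0)/nbhs_ballP[d/= d0 dP].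
pose k := n%:R * `|P| + 1.
have k0 : 0 < k by rewrite ltr_wpDl// mulr_ge0.
exists (Num.min d (r / k)); first by rewrite lt_min d0 divr_gt0.
exists [set x | N (P *m x)]; first exact: lebesgue_null_mulmx.
move=> x' xx' Nx'; exists (g (P *m x')); last first.
  rewrite gE opprD addrACA subrr add0r distrC; apply: dP.
  by apply: (le_ball _ xx'); rewrite ge_min lexx.
apply: sub_gen_smallest; exists (P *m x') => //; split=> //.
rewrite -ball_normE/= -mulmxBr; apply: le_lt_trans (mulmx_norm_le _ _) _.
have xx'k : `|x - x'| < r / k.
  by move: xx'; rewrite -ball_normE/= lt_min => /andP[].
apply: (@le_lt_trans _ _ (k * `|x - x'|)); last by rewrite mulrC -ltr_pdivlMr.
by rewrite ler_wpM2r// lerDl.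
Qed.

Lemma mulmx_continuous m (A : 'M[R]_(m, n)) : continuous (fun x : vec => A *m x).
Proof.
move=> x; suff : A *m z @[z --> x] --> A *m x by [].
apply: (@cvgrPdist_lt _ _ _ (nbhs x) _ (fun z : vec => A *m z) _).2 => e e0.
apply/nbhs_ballP.
have c0 : 0 < n%:R * `|A| + 1 by rewrite ltr_wpDl// mulr_ge0.
exists (e / (n%:R * `|A| + 1)); first by rewrite /= divr_gt0.
move=> z; rewrite -ball_normE/= ltr_pdivlMr// mulrC -mulmxBr; apply: le_lt_trans.
by rewrite (le_trans (mulmx_norm_le _ _))// ler_wpM2r// lerDl.
Qed.

(** Linear functionals of the field that depend continuously on the state are
    not affected by the convexification. *)
Lemma filippov_set_coord m (A : 'M[R]_(m, n)) f (h : vec -> 'cV[R]_m) x y :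
  (0 < n)%N -> {for x, continuous h} -> (forall x', A *m f x' = h x') ->
  filippov_set f x y -> A *m y = h x.
Proof.
move=> n0 hc fE Fy; apply/eqP; rewrite -subr_eq0 -normr_le0.
have : closure ([set 0] : set 'cV[R]_m) (A *m y - h x).
  apply: filippov_set_approx Fy => [v1 v2 l|e e0].
    rewrite !inE => -> ->.
    change (l%:num *: 0 + (1 - l%:num) *: 0 = 0 :> 'cV[R]_m).
    by rewrite !scaler0 addr0.
  move/cvgrPdist_le : hc => /(_ _ e0)/nbhs_ballP[d/= d0 dP].
  exists d => //; exists set0; first exact: lebesgue_null0.
  by move=> x' xx' _; exists 0 => //; rewrite fE sub0r opprB; exact: dP.
move=> /closure_ballP cl; apply/ler_addgt0Pr => e e0; rewrite add0r.
by have [_ ->] := cl _ e0; rewrite subr0 => /ltW.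
Qed.

End filippov_set.

(** * Transport, restriction and gluing of Filippov solutions *)

Section is_derive_mx.
Context {R : realType}.

Lemma is_derive_mxP m n (X : R -> 'M[R]_(m, n)) (t : R) (Y : 'M[R]_(m, n)) :
  is_derive t 1 X Y <-> forall i j, is_derive t 1 (fun u => X u i j) (Y i j).
Proof.
split=> [[Xt XtY] i j|XY].
  split; first exact: (derivable_mxP _ _ _).1.
  by rewrite -XtY derive_mx// mxE.
have Xt : derivable X t 1 by apply/derivable_mxP => i j; have [] := XY i j.
split=> //; rewrite derive_mx//; apply/matrixP => i j; rewrite mxE.
by have [] := XY i j.
Qed.

Lemma is_derive_mulmx m n p (A : R -> 'M[R]_(m, n)) (B : R -> 'M[R]_(n, p))
    (t : R) A' B' :
  is_derive t 1 A A' -> is_derive t 1 B B' ->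
  is_derive t 1 (fun u => A u *m B u) (A t *m B' + A' *m B t).
Proof.
move=> /is_derive_mxP AA' /is_derive_mxP BB'; apply/is_derive_mxP => i j.
have -> : (fun u => (A u *m B u) i j) =
    \sum_(k < n) ((fun u => A u i k) * (fun u => B u k j)).
  by apply/funext => u; rewrite mxE fct_sumE.
have -> : (A t *m B' + A' *m B t) i j =
    \sum_(k < n) (A t i k *: B' k j + B t k j *: A' i k).
  rewrite !mxE -big_split/=; apply: eq_bigr => k _.
  by rewrite /GRing.scale/= [A' i k * _]mulrC.
by apply: is_derive_sum => k; exact: is_deriveM.
Qed.

Lemma is_derive_mx_comp m n (X : R -> 'M[R]_(m, n)) (f : R -> R) (t : R) Y c :
  is_derive (f t) 1 X Y -> is_derive t 1 f c ->
  is_derive t 1 (X \o f) (c *: Y).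
Proof.
move=> /is_derive_mxP XY fc; apply/is_derive_mxP => i j; rewrite mxE mulrC.
exact: (@is_derive1_comp _ (fun u => X u i j)).
Qed.

Lemma near_is_derive (V : normedModType R) (f g : R -> V) (t : R) y :
  (\forall u \near t, f u = g u) -> is_derive t 1 f y -> is_derive t 1 g y.
Proof.
move=> fg [ft <-]; split; first exact: near_eq_derivable ft.
by rewrite -(near_eq_derive _ fg).
Qed.

End is_derive_mx.

Section filippov_solution.
Context {R : realType} {n : nat}.
Local Notation vec := 'cV[R]_n.
Local Notation mu := (@lebesgue_measure R).
Implicit Types (f g : R -> vec -> vec) (x : R -> vec) (s : R) (S T : \bar R).

Lemma filippov_solution_congr f g s T (x0 : vec) x :
  (forall t y, s < t -> (t%:E < T)%E -> f t y = g t y) ->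
  filippov_solution f s T x0 x -> filippov_solution g s T x0 x.
Proof.
move=> fg [xs acx aex]; split=> //; apply: filterS aex => t /= h st tT.
have [y fy xy] := h st tT; exists y => //; rewrite -(_ : f t = g t)//.
by apply/funext => z; exact: fg.
Qed.

Lemma filippov_solution_restrict f s s' T T' (x0 : vec) x :
  s <= s' -> (s'%:E < T)%E -> (T' <= T)%E ->
  filippov_solution f s T x0 x -> filippov_solution f s' T' (x s') x.
Proof.
move=> ss' s'T T'T [xs acx aex]; split=> //.
  move=> b s'b bT'; apply: abs_continuousS (acx b _ _) => //.
    exact: le_trans s'b.
  exact: lt_le_trans T'T.
apply: filterS aex => t /= h s't tT'; apply: h; first exact: le_lt_trans s't.
exact: lt_le_trans T'T.
Qed.

(** Exhaust [s, T) by the countably many intervals with a rational endpoint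
    below [T]. *)
Lemma ae_lt_ereal (s : R) T (P : R -> Prop) :
  (forall b, (b%:E < T)%E -> {ae mu, forall t, s < t -> t < b -> P t}) ->
  {ae mu, forall t, s < t -> (t%:E < T)%E -> P t}.
Proof.
move=> aeP; pose Q k t := if unpickle k is Some q then
  ((ratr q : R)%:E < T)%E -> s < t -> t < ratr q -> P t else True.
have : {ae mu, forall t, forall k, Q k t}.
  apply: ae_foralln => k; rewrite /Q; case: (unpickle k) => [q|]; last exact: aeW.
  have [qT|qT] := boolP ((ratr q : R)%:E < T)%E.
    by apply: filterS (aeP _ qT) => t.
  by apply: aeW => t.
apply: filterS => t /= Qt st tT.
have [q tq qT] : exists2 q : rat, t < ratr q & ((ratr q : R)%:E < T)%E.
  case: T tT {aeP Q Qt} => [T| |]//=.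
    rewrite lte_fin => /rat_in_itvoo[q]; rewrite in_itv/= => /andP[tq qT].
    by exists q.
  have : t < t + 1 by rewrite ltrDl.
  move=> /rat_in_itvoo[q]; rewrite in_itv/= => /andP[tq _].
  by exists q => //; rewrite ltry.
by have := Qt (pickle q); rewrite /Q pickleK; apply.
Qed.

Lemma filippov_solution_mulmx f g (M M' : R -> 'M[R]_n) s T (x0 : vec) x :
  (forall t, s < t -> (t%:E < T)%E ->
    M t \in unitmx /\ is_derive t 1 M (M' t)) ->
  (forall b, s <= b -> (b%:E < T)%E -> exists2 k, 0 <= k &
    forall p q, s <= p -> p <= q -> q <= b -> `|M q - M p| <= k * (q - p)) ->
  (forall t y, s < t -> (t%:E < T)%E ->
    g t (M t *m y) = M t *m f t y + M' t *m y) ->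
  filippov_solution f s T x0 x ->
  filippov_solution g s T (M s *m x0) (fun t => M t *m x t).
Proof.
move=> MM' ML gE [xs acx aex]; split.
- by rewrite xs.
- move=> b sb bT; have [k k0 kM] := ML _ sb bT.
  by apply: abs_continuous_mulmx kM _ => //; exact: acx.
- apply: filterS aex => t /= h st tT; have [y fy xy] := h st tT.
  have [uM dM] := MM' _ st tT.
  exists (M t *m y + M' t *m x t); last exact: is_derive_mulmx.
  have hM : {for x t, continuous (fun z : vec => M' t *m z)}.
    exact: mulmx_continuous.
  exact: (@filippov_set_affine _ _ (f t) (g t) _ _ _ _ _ uM hM
    (fun z => gE t z st tT) fy).
Qed.

(** The two bounds on the speed [c] play different parts: the upper one keeps
    [x \o theta] absolutely continuous, the lower one pulls the exceptional
    null set of [x] back to a null set. *)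
Lemma filippov_solution_time_change f g (theta c : R -> R) (sigma s : R) S T
    (x0 : vec) x :
  theta sigma = s ->
  (forall t, sigma <= t -> (t%:E < S)%E ->
    ((theta t)%:E < T)%E /\ is_derive t 1 theta (c t)) ->
  (forall b, sigma <= b -> (b%:E < S)%E -> exists m k : R, 0 < m /\
    forall t, sigma <= t -> t <= b -> m <= c t <= k) ->
  (forall t y, sigma < t -> (t%:E < S)%E -> g t y = c t *: f (theta t) y) ->
  filippov_solution f s T x0 x ->
  filippov_solution g sigma S x0 (x \o theta).
Proof.
move=> ths thP cP gE [xs acx aex].
have bilip b : sigma <= b -> (b%:E < S)%E -> exists m k : R, 0 < m /\
    forall p q, sigma <= p -> p <= q -> q <= b ->
    m * (q - p) <= theta q - theta p <= k * (q - p).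
  move=> sb bS; have [m [k [m0 mk]]] := cP _ sb bS; exists m, k; split=> // p q sp pq qb.
  have dth t : p <= t -> t <= q -> is_derive t 1 theta (c t).
    move=> pt tq; apply: (thP t _ _).2; first exact: le_trans pt.
    by apply: le_lt_trans bS; rewrite lee_fin (le_trans tq).
  have [t|t|t] := @MVT_segment R theta c p q pq.
  - by rewrite in_itv/= => /andP[pt tq]; apply: dth; exact: ltW.
  - apply: continuous_in_subspaceT => u; rewrite inE/= in_itv/= => /andP[pu uq].
    by apply/differentiable_continuous/derivable1_diffP; have [] := dth _ pu uq.
  - rewrite in_itv/= => /andP[pt tq] ->.
    have /andP[? ?] := mk t (le_trans sp pt) (le_trans tq qb).
    by rewrite !ler_wpM2r ?subr_ge0.
split.
- by rewrite /= ths.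
- move=> b sb bS; have [m [k [m0 mk]]] := bilip _ sb bS.
  have k0 : 0 <= Num.max k 0 by rewrite le_max lexx orbT.
  apply: (@abs_continuous_comp _ _ _ _ s (theta b) (Num.max k 0) x theta) => //.
    move=> p q sp pq qb; have /andP[h1 h2] := mk _ _ sp pq qb.
    have mono u v : sigma <= u -> u <= v -> v <= b -> theta u <= theta v.
      move=> su uv vb; have /andP[h _] := mk _ _ su uv vb.
      by rewrite -subr_ge0 (le_trans _ h)// mulr_ge0 ?subr_ge0// ltW.
    split.
    + by rewrite -ths; apply: mono => //; exact: le_trans qb.
    + exact: mono.
    + by apply: mono => //; exact: le_trans pq.
    + by rewrite (le_trans h2)// ler_wpM2r ?subr_ge0// le_max lexx.
  apply: acx; last exact: (thP _ sb bS).1.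
  have /andP[h _] := mk _ _ (lexx sigma) sb (lexx b).
  by rewrite -ths -subr_ge0 (le_trans _ h)// mulr_ge0 ?subr_ge0// ltW.
- apply: ae_lt_ereal => b bS.
  have [bs|sb] := ltP b sigma.
    by apply: aeW => t st tb; have := lt_trans st (lt_trans tb bs); rewrite ltxx.
  have [m [k [m0 mk]]] := bilip _ sb bS.
  have expand p q : `[sigma, b]%classic p -> `[sigma, b]%classic q ->
      `|p - q| <= m^-1 * `|theta p - theta q|.
    rewrite /= !in_itv/= => /andP[sp pb] /andP[sq qb].
    wlog pq : p q sp pb sq qb / q <= p.
      move=> h; have [|/ltW] := leP q p; first exact: h.
      by rewrite distrC [X in _ * X]distrC; exact: h.
    have /andP[h _] := mk _ _ sq pq pb.
    rewrite ger0_norm ?subr_ge0// mulrC ler_pdivlMr// mulrC (le_trans h)//.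
    exact: ler_norm.
  have := @negligible_preimage_expanding R theta _ _ _ _ expand aex.
  rewrite invr_gt0 => /(_ m0); apply: negligibleS => t/= nP; split.
    apply: contrapT => tsb; apply: nP => st tb; exfalso; apply: tsb.
    by rewrite in_itv/= !ltW.
  move=> h; apply: nP => st tb.
  have tS : (t%:E < S)%E by apply: lt_trans bS; rewrite lte_fin.
  have [thT dth] := thP _ (ltW st) tS.
  have [||y fy xy] := h => //.
    have /andP[h' _] := mk _ _ (lexx sigma) (ltW st) (ltW tb).
    by rewrite -ths -subr_gt0 (lt_le_trans _ h')// mulr_gt0 ?subr_gt0.
  exists (c t *: y); last exact: is_derive_mx_comp.
  have := @filippov_set_affine _ _ (f (theta t)) (g t) 1%:M (c t)%:M (fun=> 0)
    (x (theta t)) y.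
  rewrite !mul1mx addr0 mul_scalar_mx; apply.
  - exact: unitmx1.
  - exact: cst_continuous.
  - by move=> z; rewrite mul1mx addr0 mul_scalar_mx gE.
  - exact: fy.
Qed.

(** Clipping the time to the two sides of [c] writes the glued curve as a sum of
    [x1] and [x2] composed with nondecreasing 1-Lipschitz functions, which
    gives absolute continuity; the junction is a single instant. *)
Lemma filippov_solution_glue f (s c : R) T (x0 : vec) x1 x2 : s <= c ->
  abs_continuous s c x1 -> filippov_solution f s c%:E x0 x1 ->
  filippov_solution f c T (x1 c) x2 ->
  filippov_solution f s T x0 (fun t => if t < c then x1 t else x2 t).
Proof.
move=> sc acc [x1s acx1 aex1] [x2c acx2 aex2]; set x := fun t => _.
(* One of the two clipped times is always [c], where [x1] and [x2] agree. *)
have xE t : x t = x1 (Num.min t c) + x2 (Num.max t c) - x2 c.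
  rewrite /x; case: ltP => tc; last by rewrite x2c addrC addKr.
  by rewrite addrK.
split.
- rewrite /x; case: ltP => // cs; rewrite -x1s.
  by have -> : s = c by apply/eqP; rewrite eq_le sc.
- move=> b sb bT.
  have [bc|cb] := ltP b c.
    have acx1b : abs_continuous s b x1.
      exact: acx1.
    apply: (@abs_continuous_dominated _ _ _ _ s b 1 x x1 x1) => //.
    move=> p q sp pq qb; have pc := le_lt_trans (le_trans pq qb) bc.
    by rewrite /x pc (le_lt_trans qb bc) mul1r lerDl.
  apply: (@abs_continuous_dominated _ _ _ _ s b 1 x
    (fun t => x1 (Num.min t c)) (fun t => x2 (Num.max t c))) => //.
  + move=> p q sp pq qb; rewrite !xE mul1r; apply: le_trans (ler_normD _ _).
    by rewrite opprB addrA subrK opprD addrACA.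
  + apply: (@abs_continuous_comp _ _ _ _ s c 1 x1 (fun t : R => Num.min t c)) => //.
    move=> p q sp pq qb; rewrite mul1r !minEle; split; do ?case: ifP; lra.
  + apply: (@abs_continuous_comp _ _ _ _ c b 1 x2 (fun t : R => Num.max t c)) => //;
      last exact: acx2.
    move=> p q sp pq qb; rewrite mul1r !maxEle; split; do ?case: ifP; lra.
- have aec : {ae mu, forall t, t != c}.
    exists [set c]; split=> //; first exact: lebesgue_measure_set1.
    by move=> t /= /negP/negPn/eqP.
  apply: filterS3 aec aex1 aex2 => t /= tc h1 h2 st tT.
  have [tc'|ct] := ltP t c.
    have [//|y fy xy] := h1 st.
    exists y; first by rewrite /x tc'.
    apply: near_is_derive xy; near=> u; rewrite /x ifT//.
    by near: u; exact: lt_nbhsl.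
  have ct' : c < t by rewrite lt_neqAle eq_sym tc ct.
  have [//|y fy xy] := h2 ct'; exists y; first by rewrite /x ltNge ct.
  apply: near_is_derive xy; near=> u; rewrite /x ifF//.
  by apply/negbTE; rewrite -leNgt ltW//; near: u; exact: lt_nbhsr.
Unshelve. all: by end_near. Qed.
End filippov_solution.

(** * The companion structure of the auxiliary coordinates *)

Section algebra.
Context {R : realType} (n : nat) (alpha rho : R).
Local Notation A := (Jmx n - alpha *: Dmx n rho).
Local Notation Q := (Qmx n alpha rho).
Local Notation b1 := ((bvec n 1)^T : 'rV[R]_n).

(** At [kappa = expR l] this is the power [r] of the matrix [K_rho].  Working
    with the logarithm [l] makes the entries exponentials. *)
Definition scaling_mx (r l : R) : 'M[R]_n :=
  diag_mx (\row_i expR (r * (i%:R - rho) * l)).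

Lemma companion_entry (i j : 'I_n) :
  A i j = (j == i.+1 :> nat)%:R - (alpha * (i%:R - rho)) *+ (i == j).
Proof. by rewrite !mxE -mulrnAr. Qed.

(** Each factor [A] moves the first basis row one place to the right, with
    coefficient 1; the diagonal part of [A] keeps entries in place, hence to
    the left of the new leading entry. *)
Lemma krylov_entry k (j : 'I_n) : (k <= j)%N ->
  (b1 *m A ^+ k) ord0 j = (k == j :> nat)%:R.
Proof.
elim: k j => [|k IH] j kj.
  by rewrite expr0 mulmx1 !mxE eqSS eq_sym.
rewrite exprSr mulmxA mxE.
rewrite (bigD1 (Ordinal (leq_ltn_trans (leq_pred j) (ltn_ord j))))//=.
have j0 : (0 < j)%N by apply: leq_trans kj.
rewrite IH/=; last by rewrite -ltnS prednK.
rewrite companion_entry/= prednK// eqxx.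
have /negbTE -> : Ordinal (leq_ltn_trans (leq_pred j) (ltn_ord j)) != j.
  by apply/eqP => /(congr1 val)/=; lia.
rewrite subr0 mulr1 big1 => [|i ij].
  by rewrite addr0 -[in RHS](prednK j0) eqSS.
have [ik|ki] := leqP k i; last first.
  rewrite companion_entry (_ : (j == i.+1 :> nat) = false).
    rewrite (_ : (i == j) = false) ?subr0 ?mulr0//.
    by apply/eqP => ij'; move: ki kj; rewrite ij'; lia.
  by apply/eqP; lia.
rewrite IH//.
have [ki|ki] := eqVneq k i; last by rewrite mul0r.
rewrite companion_entry (_ : (j == i.+1 :> nat) = false).
  rewrite (_ : (i == j) = false) ?subr0 ?mulr0//.
  by apply/eqP => ij'; move: kj; rewrite -ij' ki; lia.
by apply/eqP => ji; move/eqP: ij; apply; apply/val_inj; rewrite /= ji.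
Qed.

Lemma Qmx_entry (k j : 'I_n) : Q k j = (b1 *m A ^+ k) ord0 j.
Proof. by rewrite mxE. Qed.

Lemma Qmx_unit : Q \in unitmx.
Proof.
rewrite unitmxE det_trig.
  by rewrite big1 ?unitr1// => i _; rewrite Qmx_entry krylov_entry ?eqxx.
apply/is_trig_mxP => i j ij; rewrite Qmx_entry krylov_entry ?ltn_eqF//.
exact: ltnW.
Qed.

Lemma Qmx_bvec : (0 < n)%N -> Q *m bvec n n = bvec n n.
Proof.
move=> n0; apply/matrixP => i j; rewrite !mxE.
have nn : (n.-1 < n)%N by rewrite prednK.
rewrite (bigD1 (Ordinal nn))//= big1 => [|k kn].
  rewrite addr0 [bvec n n _ _]mxE/= prednK// eqxx mulr1 Qmx_entry krylov_entry/=.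
    by congr (nat_of_bool _)%:R; apply/eqP/eqP; lia.
  by rewrite -ltnS prednK.
rewrite [bvec n n _ _]mxE (_ : (k.+1 == n) = false) ?mulr0//.
apply/eqP => kn'; move/eqP: kn; apply; apply/val_inj => /=; lia.
Qed.

(** Multiplying by [A] on the right shifts the Krylov rows up by one, and this
    is the action of [Jmx] on the left except in the last row. *)
Lemma Qmx_companion :
  Q *m A = Jmx n *m Q + bvec n n *m (b1 *m A ^+ n).
Proof.
apply/matrixP => i j; rewrite [RHS]mxE.
have -> : (Q *m A) i j = (b1 *m A ^+ i.+1) ord0 j.
  rewrite exprSr mulmxA !mxE; apply: eq_bigr => k _.
  by rewrite Qmx_entry.
have -> : (bvec n n *m (b1 *m A ^+ n)) i j =
    (i.+1 == n)%:R * (b1 *m A ^+ n) ord0 j.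
  by rewrite mxE big_ord1 mxE.
have [ni|ni] := eqVneq i.+1 n.
  rewrite ni mul1r [(_ *m Q) i j]mxE big1 ?add0r// => k _; rewrite mxE.
  rewrite (_ : (k == i.+1 :> nat) = false) ?mul0r//.
  by apply/eqP; have := ltn_ord k; lia.
have i1 : (i.+1 < n)%N by rewrite ltn_neqAle ni ltn_ord.
rewrite mul0r addr0 [RHS]mxE (bigD1 (Ordinal i1))//= big1 => [|k ki].
  by rewrite addr0 [Jmx n _ _]mxE eqxx mul1r Qmx_entry.
rewrite mxE (_ : (k == i.+1 :> nat) = false) ?mul0r//.
by apply/eqP => ki'; move/eqP: ki; apply; apply/val_inj.
Qed.

Lemma scaling_mxK r l : scaling_mx r l *m scaling_mx (- r) l = 1%:M.
Proof.
rewrite /scaling_mx mulmx_diag -diag_const_mx; congr diag_mx.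
apply/rowP => i; rewrite !mxE -expRD -[RHS]expR0; congr expR; ring.
Qed.

Lemma scaling_mx_unit r l : scaling_mx r l \in unitmx.
Proof. by have [] := mulmx1_unit (scaling_mxK r l). Qed.

Lemma invmx_scaling r l : invmx (scaling_mx r l) = scaling_mx (- r) l.
Proof.
by rewrite -[LHS]mulmx1 -(scaling_mxK r l) mulKmx// scaling_mx_unit.
Qed.

Lemma scaling_mx_D r l :
  scaling_mx r l *m Dmx n rho = Dmx n rho *m scaling_mx r l.
Proof.
rewrite /scaling_mx /Dmx !mulmx_diag; congr diag_mx.
by apply/rowP => i; rewrite !mxE mulrC.
Qed.

(** [Jmx] shifts coordinates by one, and consecutive entries of the scaling
    differ by a factor [kappa]; this is the factor which the change of time
    removes. *)
Lemma scaling_mx_J l :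
  scaling_mx (-1) l *m Jmx n = expR l *: (Jmx n *m scaling_mx (-1) l).
Proof.
apply/matrixP => i j; rewrite mul_diag_mx mxE mxE [RHS]mxE mul_mx_diag !mxE.
have [ji|ji] := eqVneq (j : nat) i.+1; last by rewrite !(mulr0, mul0r).
rewrite mulr1 mul1r -expRD ji; congr expR; rewrite -natr1; ring.
Qed.

Lemma scaling_mx_bvec l : (0 < n)%N ->
  scaling_mx (-1) l *m bvec n n = expR (- (n%:R - 1 - rho) * l) *: bvec n n.
Proof.
move=> n0; apply/matrixP => i j; rewrite mul_diag_mx mxE !mxE.
have [in_|_] := eqVneq i.+1 n; last by rewrite !mulr0.
have -> : i%:R = n%:R - 1 :> R by rewrite -[in RHS]in_ -natr1 addrK.
by rewrite !mulr1; congr expR; ring.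
Qed.

Lemma bvec_col_mul (c : 'M[R]_1) :
  bvec n n *m c = c ord0 ord0 *: (bvec n n : 'cV[R]_n).
Proof. by rewrite [c in LHS]mx11_scalar mul_mx_scalar. Qed.

(** The second term on the left is the derivative of the change of coordinates
    applied to [x].  Together with the scaled chain [Jmx] it produces
    [Jmx - alpha *: Dmx] acting on [K^-1 x], and [Q] turns this into a companion
    form whose last row appears as the extra input on the right. *)
Lemma companion_change_of_variables (beta l w : R) (x : 'cV[R]_n) : (0 < n)%N ->
  (beta^-1 *: (Q *m scaling_mx (-1) l)) *m
      (expR (- l) *: (Jmx n *m x + w *: bvec n n)) +
    (- alpha * beta^-1) *: (Q *m Dmx n rho *m scaling_mx (-1) l) *m x =
  Jmx n *m (beta^-1 *: (Q *m scaling_mx (-1) l) *m x) +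
   beta^-1 * (expR (- (n%:R - rho) * l) * w +
    (b1 *m A ^+ n *m scaling_mx (-1) l *m x) ord0 ord0) *: bvec n n.
Proof.
move=> n0; set E := scaling_mx (-1) l.
have EJ : expR (- l) *: (Q *m E *m Jmx n *m x) = Q *m Jmx n *m E *m x.
  rewrite -[Q *m E *m _]mulmxA scaling_mx_J -/E -!scalemxAr -!scalemxAl scalerA.
  by rewrite -expRD addNr expR0 scale1r !mulmxA.
have Eb : expR (- l) *: (Q *m E *m bvec n n) =
    expR (- (n%:R - rho) * l) *: bvec n n.
  rewrite -mulmxA scaling_mx_bvec// -scalemxAr Qmx_bvec// scalerA -expRD.
  by congr (expR _ *: _); ring.
have QA : Q *m Jmx n *m E *m x = Jmx n *m Q *m E *m x +
    alpha *: (Q *m Dmx n rho *m E *m x)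
    + (b1 *m A ^+ n *m E *m x) ord0 ord0 *: bvec n n.
  rewrite -bvec_col_mul !mulmxA -[bvec n n *m b1 *m _]mulmxA.
  have -> : Q *m Jmx n = Jmx n *m Q + bvec n n *m (b1 *m A ^+ n) +
      alpha *: (Q *m Dmx n rho).
    by rewrite -Qmx_companion mulmxBr -scalemxAr subrK.
  by rewrite !mulmxDl -!scalemxAl addrAC !mulmxA.
rewrite -!scalemxAl -!scalemxAr mulmxDr scalerDr -scalemxAr mulmxA EJ.
rewrite [expR _ *: (w *: _)]scalerA [X in X *: (Q *m E *m bvec n n)]mulrC.
rewrite -[(w * _) *: _]scalerA Eb QA.
rewrite !mulmxA -/E; apply/matrixP => i j; rewrite !mxE; ring.
Qed.

End algebra.

(** * The two time scales and the scaling matrices *)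

Section time_maps.
Context {R : realType}.
Variables (alpha c0 : R).
Hypotheses (alpha0 : 0 <= alpha) (c00 : 0 < c0).

(** The plant time as a function of the auxiliary time; it solves
    [dt/dtau = 1 / kappa]. *)
Definition plant_time (tau : R) : R :=
  if alpha == 0 then tau / c0 else (1 - expR (- alpha * tau)) / (alpha * c0).

Definition aux_time (t : R) : R :=
  if alpha == 0 then c0 * t else - ln (1 - alpha * c0 * t) / alpha.

(** The logarithm of kappa in the auxiliary time, where kappa grows at the
    exponential rate [alpha]. *)
Definition log_kappa (tau : R) : R := ln c0 + alpha * tau.

Lemma plant_time_denom tau :
  1 - alpha * c0 * plant_time tau = expR (- alpha * tau).
Proof.
rewrite /plant_time; have [->|a0] := eqVneq alpha 0.
  by rewrite !mul0r subr0 oppr0 mul0r expR0.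
by field; rewrite a0 gt_eqF.
Qed.

Lemma expR_log_kappa tau :
  expR (log_kappa tau) = c0 / (1 - alpha * c0 * plant_time tau).
Proof. by rewrite plant_time_denom expRD lnK// mulNr expRN invrK. Qed.

Lemma is_derive_plant_time (tau : R) :
  is_derive tau 1 plant_time (expR (- log_kappa tau)).
Proof.
have -> : expR (- log_kappa tau) = expR (- alpha * tau) / c0.
  by rewrite opprD expRD expRN lnK// mulrC mulNr.
rewrite /plant_time; have [->|a0] := eqVneq alpha 0.
  rewrite oppr0 mul0r expR0.
  have -> : (fun t : R => t / c0) = c0^-1 \*: id.
    by apply/funext => t; rewrite /GRing.scale/= mulrC.
  by rewrite mul1r -[X in is_derive _ _ _ X]mulr1; exact: is_deriveZ.
have d1 : is_derive tau 1 (fun t => expR (- alpha * t))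
    (expR (- alpha * tau) * - alpha).
  apply: (@is_derive1_comp _ expR (fun t => - alpha * t)).
  rewrite -[X in is_derive _ _ _ X]mulr1; exact: is_deriveZ.
have -> : (fun t => (1 - expR (- alpha * t)) / (alpha * c0)) =
    (alpha * c0)^-1 \*: (cst 1 - (fun t => expR (- alpha * t))).
  by apply/funext => t; rewrite /GRing.scale/= mulrC.
have -> : expR (- alpha * tau) / c0 =
    (alpha * c0)^-1 *: (0 - (expR (- alpha * tau) * - alpha)).
  by rewrite /GRing.scale/=; field; rewrite a0 gt_eqF.
exact: is_deriveZ.
Qed.

Lemma plant_timeK tau : aux_time (plant_time tau) = tau.
Proof.
rewrite /aux_time plant_time_denom /plant_time; have [a0|a0] := eqVneq alpha 0.
  by rewrite mulrC divfK// gt_eqF.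
by rewrite expRK; field.
Qed.

Lemma aux_timeK t : 0 < 1 - alpha * c0 * t -> plant_time (aux_time t) = t.
Proof.
rewrite /aux_time /plant_time; have [a0|a0] := eqVneq alpha 0 => t0.
  by rewrite mulrC mulKf// gt_eqF.
have -> : - alpha * (- ln (1 - alpha * c0 * t) / alpha) = ln (1 - alpha * c0 * t).
  by field.
by rewrite lnK//; field; rewrite a0 gt_eqF.
Qed.

Lemma plant_time_lt tau1 tau2 : tau1 < tau2 -> plant_time tau1 < plant_time tau2.
Proof.
rewrite /plant_time => t12; have [_|a0] := eqVneq alpha 0.
  by rewrite ltr_pM2r// invr_gt0.
have a0' : 0 < alpha by rewrite lt_neqAle eq_sym a0.
rewrite ltr_pM2r ?invr_gt0 ?mulr_gt0// ltrD2l ltrN2 ltr_expR !mulNr ltrN2.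
by rewrite ltr_pM2l.
Qed.

Lemma plant_time_le tau1 tau2 : tau1 <= tau2 -> plant_time tau1 <= plant_time tau2.
Proof. by rewrite le_eqVlt => /orP[/eqP->//|/plant_time_lt/ltW]. Qed.

Lemma aux_time_lt t1 t2 : 0 < 1 - alpha * c0 * t2 -> t1 < t2 ->
  aux_time t1 < aux_time t2.
Proof.
move=> h2 t12; have h1 : 0 < 1 - alpha * c0 * t1.
  by apply: lt_le_trans h2 _; rewrite lerD2l lerN2 ler_wpM2l ?(ltW t12)// mulr_ge0// ltW.
rewrite ltNge; apply/negP => /plant_time_le; rewrite !aux_timeK// leNgt.
by rewrite t12.
Qed.

Lemma aux_time_le t1 t2 : 0 < 1 - alpha * c0 * t2 -> t1 <= t2 ->
  aux_time t1 <= aux_time t2.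
Proof. by move=> h; rewrite le_eqVlt => /orP[/eqP->//|/(aux_time_lt h)/ltW]. Qed.

Lemma is_derive_aux_time (t : R) : 0 < 1 - alpha * c0 * t ->
  is_derive t 1 aux_time (expR (log_kappa (aux_time t))).
Proof.
move=> t0; rewrite expR_log_kappa aux_timeK//.
rewrite /aux_time; have [a0|a0] := eqVneq alpha 0.
  rewrite a0 !mul0r subr0 divr1.
  by rewrite -[X in is_derive _ _ _ X]mulr1; exact: is_deriveZ.
have d1 : is_derive t 1 (fun u => 1 - alpha * c0 * u) (0 - alpha * c0 * 1).
  by apply: is_deriveB; exact: is_deriveZ.
have d2 := @is_derive1_comp _ (@ln R) _ t _ _ (is_derive1_ln t0) d1.
have -> : (fun u => - ln (1 - alpha * c0 * u) / alpha) =
    (- alpha^-1) \*: ((@ln R) \o (fun u => 1 - alpha * c0 * u)).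
  by apply/funext => u; rewrite /GRing.scale/= mulNr [RHS]mulNr mulrC.
have -> : c0 / (1 - alpha * c0 * t) =
   - alpha^-1 *: ((1 - alpha * c0 * t)^-1 * (0 - alpha * c0 * 1)).
  by rewrite /GRing.scale/=; field; rewrite a0 gt_eqF.
exact: is_deriveZ.
Qed.

Lemma plant_time0 : plant_time 0 = 0.
Proof.
by rewrite /plant_time; case: ifP => _; rewrite ?mul0r// mulr0 expR0 subrr mul0r.
Qed.

Lemma aux_time0 : aux_time 0 = 0.
Proof. by rewrite -[in LHS]plant_time0 plant_timeK. Qed.

End time_maps.

Section scaling.
Context {R : realType} (n : nat).
Variables (alpha rho c0 : R).
Hypotheses (alpha0 : 0 <= alpha).
Local Notation L := (log_kappa alpha c0).

Lemma is_derive_scaling_mx (r tau : R) :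
  is_derive tau 1 (fun t => scaling_mx n rho r (L t))
    ((r * alpha) *: (Dmx n rho *m scaling_mx n rho r (L tau))).
Proof.
apply/is_derive_mxP => i j.
have -> : (fun t => scaling_mx n rho r (L t) i j) =
    (i == j)%:R \*: (expR \o (fun t => r * (i%:R - rho) * L t)).
  apply/funext => t; rewrite !mxE.
  by case: eqP => [_|_]; rewrite ?mulr1n ?mulr0n /= ?scale1r ?scale0r.
have -> : ((r * alpha) *: (Dmx n rho *m scaling_mx n rho r (L tau))) i j =
   (i == j)%:R *: (expR (r * (i%:R - rho) * L tau) *
     (r * (i%:R - rho) * (0 + alpha * 1))).
  rewrite mxE mul_diag_mx !mxE; case: eqP => [_|_].
    by rewrite mulr1n scale1r; ring.
  by rewrite mulr0n scale0r !mulr0.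
apply: is_deriveZ; apply: (@is_derive1_comp _ expR).
Qed.

Lemma expR_lipschitz (K u v : R) : u <= K -> v <= K ->
  `|expR u - expR v| <= expR K * `|u - v|.
Proof.
wlog uv : u v / v <= u.
  move=> h uK vK; have [vu|/ltW uv] := leP v u; first exact: h.
  by rewrite distrC [X in _ * X]distrC; exact: h.
move=> uK _; rewrite !ger0_norm ?subr_ge0 ?ler_expR//.
apply: (@le_trans _ _ (expR u * (u - v))); last first.
  by rewrite ler_wpM2r ?subr_ge0 ?ler_expR.
have := expR_ge1Dx (v - u); rewrite -(ler_pM2l (expR_gt0 u)) -expRD.
have -> : u + (v - u) = v by ring.
by lra.
Qed.

Lemma scaling_mx_lipschitz (r a b : R) : exists2 k, 0 <= k &
  forall p q, a <= p -> p <= q -> q <= b ->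
    `|scaling_mx n rho r (L q) - scaling_mx n rho r (L p)| <= k * (q - p).
Proof.
pose W := `|r| * (n%:R + `|rho|).
have W0 : 0 <= W by rewrite mulr_ge0// addr_ge0.
have WP (i : 'I_n) : `|r * (i%:R - rho)| <= W.
  rewrite normrM ler_wpM2l// (le_trans (ler_normB _ _))// lerD2r normr_nat ler_nat.
  exact: ltnW.
pose K := W * (`|ln c0| + alpha * (`|a| + `|b|)).
exists (expR K * (W * alpha)); first by rewrite !mulr_ge0// expR_ge0.
move=> p q ap pq qb; apply: mx_norm_leP => [|i j].
  by rewrite !mulr_ge0 ?expR_ge0// subr_ge0.
have LK t : a <= t -> t <= b -> r * (i%:R - rho) * L t <= K.
  move=> at_ tb; apply: le_trans (ler_norm _) _; rewrite normrM.
  apply: ler_pM => //; apply: le_trans (ler_normD _ _) _.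
  rewrite lerD2l normrM (ger0_norm alpha0) ler_wpM2l//.
  rewrite ler_norml; have := ler_norm b; have := ler_norm (- a); rewrite normrN.
  have := normr_ge0 a; have := normr_ge0 b; lra.
rewrite !mxE; case: eqP => [_|_]; last first.
  by rewrite !mulr0n subrr normr0 !mulr_ge0 ?expR_ge0// subr_ge0.
rewrite !mulr1n; apply: le_trans (expR_lipschitz (LK q _ _) (LK p _ _)) _ => //.
- exact: le_trans pq.
- exact: le_trans qb.
rewrite -[leRHS]mulrA ler_wpM2l ?expR_ge0//.
have -> : r * (i%:R - rho) * L q - r * (i%:R - rho) * L p =
    (r * (i%:R - rho)) * (alpha * (q - p)) by rewrite /log_kappa; ring.
rewrite normrM -[leRHS]mulrA; apply: ler_pM => //.
by rewrite ger0_norm// mulr_ge0// subr_ge0.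
Qed.

Lemma mulmx_lipschitz (P P' : 'M[R]_n) (X : R -> 'M[R]_n) (a b : R) :
  (exists2 k, 0 <= k & forall p q, a <= p -> p <= q -> q <= b ->
     `|X q - X p| <= k * (q - p)) ->
  exists2 k, 0 <= k & forall p q, a <= p -> p <= q -> q <= b ->
    `|P *m X q *m P' - P *m X p *m P'| <= k * (q - p).
Proof.
move=> [k k0 kX]; exists (n%:R * (n%:R * `|P| * k) * `|P'|).
  by rewrite !mulr_ge0.
move=> p q ap pq qb; rewrite -mulmxBl -mulmxBr.
apply: le_trans (mulmx_norm_le _ _) _.
have -> : n%:R * (n%:R * `|P| * k) * `|P'| * (q - p) =
  n%:R * (n%:R * `|P| * (k * (q - p))) * `|P'| by ring.
rewrite ler_wpM2r// ler_wpM2l//; apply: le_trans (mulmx_norm_le _ _) _.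
by rewrite ler_wpM2l ?mulr_ge0// kX.
Qed.

End scaling.

(** * Solutions of the plant and of the auxiliary system *)

Section correspondence.
Context {R : realType} (n : nat).
Local Notation vec := 'cV[R]_n.
Variables (alpha rho : R) (Tf : \bar R) (Tc beta c0 : R) (v : vec -> R).
Hypotheses (n0 : (0 < n)%N) (alpha0 : 0 <= alpha) (c00 : 0 < c0) (beta0 : 0 < beta).
Hypothesis kappaE : forall t, kappa alpha Tf Tc t = c0 / (1 - alpha * c0 * t).
Local Notation Q := (Qmx n alpha rho).
Local Notation L := (log_kappa alpha c0).
Local Notation theta := (plant_time alpha c0).
Local Notation tau_of := (aux_time alpha c0).

Definition to_aux (tau : R) : 'M[R]_n :=
  beta^-1 *: (Q *m scaling_mx n rho (-1) (L tau)).

Definition to_plant (tau : R) : 'M[R]_n :=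
  beta *: (scaling_mx n rho 1 (L tau) *m invmx Q).

(** The disturbance of the auxiliary system,
    [beta^-1 kappa^(rho - n) d]. *)
Definition aux_dist (d : R -> R) (tau : R) : R :=
  beta^-1 * expR (- (n%:R - rho) * L tau) * d (theta tau).

Lemma to_plantK tau : to_aux tau *m to_plant tau = 1%:M.
Proof.
rewrite /to_aux /to_plant -scalemxAl -scalemxAr scalerA mulVf ?gt_eqF// scale1r.
rewrite -mulmxA [X in Q *m X]mulmxA.
rewrite -[X in scaling_mx _ _ _ _ *m scaling_mx _ _ X _]opprK.
by rewrite scaling_mxK mul1mx mulmxV// Qmx_unit.
Qed.

Lemma to_auxK tau : to_plant tau *m to_aux tau = 1%:M.
Proof. by apply: mulmx1C; exact: to_plantK. Qed.

Lemma to_aux_unit tau : to_aux tau \in unitmx.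
Proof. by have [] := mulmx1_unit (to_plantK tau). Qed.

Lemma to_plant_unit tau : to_plant tau \in unitmx.
Proof. by have [] := mulmx1_unit (to_plantK tau). Qed.

(** The powers of kappa in phi become exponentials of [log_kappa], and [K^-1]
    becomes a scaling matrix. *)
Lemma phiE x tau :
  phi alpha rho Tf Tc beta v x (theta tau) =
  beta * expR ((n%:R - rho) * L tau) * (v (to_aux tau *m x) - beta^-1 *
    ((bvec n 1)^T *m (Jmx n - alpha *: Dmx n rho) ^+ n *m
       scaling_mx n rho (-1) (L tau) *m x) ord0 ord0).
Proof.
have kE : kappa alpha Tf Tc (theta tau) = expR (L tau).
  by rewrite kappaE expR_log_kappa.
have powE r : kappa alpha Tf Tc (theta tau) `^ r = expR (r * L tau).
  by rewrite kE /powR gt_eqF ?expR_gt0// expRK.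
have KE : invmx (Kmx n alpha rho Tf Tc (theta tau)) = scaling_mx n rho (-1) (L tau).
  rewrite -invmx_scaling; congr (invmx (diag_mx _)).
  by apply/rowP => i; rewrite !mxE powE mul1r.
by rewrite /phi powE KE /to_aux -scalemxAl.
Qed.

(** The last row of the companion form is cancelled by the second term of phi,
    and the gain [beta kappa^(n - rho)] in phi by the scaling of the input. *)
Lemma aux_field_change_of_variables d tau x :
  chain_field (fun z _ => v z) (aux_dist d) tau (to_aux tau *m x) =
  to_aux tau *m (expR (- L tau) *:
     chain_field (phi alpha rho Tf Tc beta v) d (theta tau) x) +
  ((- alpha * beta^-1) *: (Q *m Dmx n rho *m scaling_mx n rho (-1) (L tau))) *m x.
Proof.
rewrite /chain_field companion_change_of_variables// -/(to_aux tau).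
congr (_ + _ *: _).
rewrite phiE /aux_dist; set V := v _; set B := (_ *m x) _ _.
have E : expR (- (n%:R - rho) * L tau) * expR ((n%:R - rho) * L tau) = 1.
  by rewrite -expRD mulNr addNr expR0.
set e1 := expR (- (n%:R - rho) * _) in E *; set e2 := expR _ in E *.
have -> : beta^-1 * (e1 * (beta * e2 * (V - beta^-1 * B) + d (theta tau)) + B) =
  (e1 * e2) * V - (e1 * e2 - 1) * (beta^-1 * B) + beta^-1 * e1 * d (theta tau).
  by field; rewrite gt_eqF.
by rewrite E subrr mul0r subr0 mul1r.
Qed.

Lemma is_derive_to_aux (tau : R) : is_derive tau 1 to_aux
  ((- alpha * beta^-1) *: (Q *m Dmx n rho *m scaling_mx n rho (-1) (L tau))).
Proof.
have := is_derive_mulmx (@is_derive_cst _ _ _ (beta^-1 *: Q) tau 1)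
  (is_derive_scaling_mx n alpha rho c0 (-1) tau).
rewrite mul0mx addr0 -scalemxAr mulN1r -scalemxAl !scalerA mulmxA.
have -> // : (fun u => cst (beta^-1 *: Q) u *m scaling_mx n rho (-1) (L u)) =
  to_aux.
by apply/funext => u; rewrite /to_aux scalemxAl.
Qed.

Lemma is_derive_to_plant (tau : R) : is_derive tau 1 to_plant
  ((alpha * beta) *: (Dmx n rho *m scaling_mx n rho 1 (L tau) *m invmx Q)).
Proof.
have := is_derive_mulmx (is_derive_scaling_mx n alpha rho c0 1 tau)
  (@is_derive_cst _ _ _ (beta *: invmx Q) tau 1).
rewrite mulmx0 add0r mul1r -scalemxAl -scalemxAr scalerA.
have -> // : (fun u => scaling_mx n rho 1 (L u) *m cst (beta *: invmx Q) u) =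
  to_plant.
by apply/funext => u; rewrite /to_plant scalemxAr.
Qed.

Lemma to_aux_lipschitz a b : exists2 k, 0 <= k &
  forall p q, a <= p -> p <= q -> q <= b ->
  `|to_aux q - to_aux p| <= k * (q - p).
Proof.
have [k k0 kP] := mulmx_lipschitz (beta^-1 *: Q) 1%:M
  (scaling_mx_lipschitz n rho c0 alpha0 (-1) a b).
exists k => // p q ap pq qb.
by have := kP _ _ ap pq qb; rewrite !mulmx1 -!scalemxAl.
Qed.

Lemma to_plant_lipschitz a b : exists2 k, 0 <= k &
  forall p q, a <= p -> p <= q -> q <= b ->
  `|to_plant q - to_plant p| <= k * (q - p).
Proof.
have [k k0 kP] := mulmx_lipschitz 1%:M (beta *: invmx Q)
  (scaling_mx_lipschitz n rho c0 alpha0 1 a b).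
exists k => // p q ap pq qb.
by have := kP _ _ ap pq qb; rewrite !mul1mx -!scalemxAr.
Qed.

Lemma plant_to_aux d (sigma : R) (S T : \bar R) x0 x :
  (forall tau, sigma <= tau -> (tau%:E < S)%E -> ((theta tau)%:E < T)%E) ->
  chain_solution (phi alpha rho Tf Tc beta v) d (theta sigma) T x0 x ->
  chain_solution (fun z _ => v z) (aux_dist d) sigma S (to_aux sigma *m x0)
    (fun tau => to_aux tau *m x (theta tau)).
Proof.
move=> ST xsol.
pose G tau y := expR (- L tau) *: chain_field (phi alpha rho Tf Tc beta v) d (theta tau) y.
have ysol : filippov_solution G sigma S x0 (x \o theta).
  apply: (filippov_solution_time_change (c := fun tau => expR (- L tau))
    _ _ _ _ xsol) => //.
    by move=> tau st tS; split; [exact: ST|exact: is_derive_plant_time].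
  move=> b sb bS; exists (expR (- L b)), (expR (- L sigma)).
  split; first exact: expR_gt0.
  by move=> t st tb; rewrite !ler_expR !lerN2 !lerD2l !ler_wpM2l.
apply: (filippov_solution_mulmx (M' := fun tau =>
  (- alpha * beta^-1) *: (Q *m Dmx n rho *m scaling_mx n rho (-1) (L tau)))
  _ _ _ ysol).
- by move=> t _ _; split; [exact: to_aux_unit|exact: is_derive_to_aux].
- by move=> b _ _; exact: to_aux_lipschitz.
- by move=> t y _ _; exact: aux_field_change_of_variables.
Qed.

(** Here the coordinates are changed first, while time is still [tau] and they
    are exponentials, and time is changed afterwards. *)
Lemma aux_to_plant d (s : R) (S T : \bar R) z0 z :
  (forall t, s <= t -> (t%:E < T)%E ->
    0 < 1 - alpha * c0 * t /\ ((tau_of t)%:E < S)%E) ->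
  chain_solution (fun z _ => v z) (aux_dist d) (tau_of s) S z0 z ->
  chain_solution (phi alpha rho Tf Tc beta v) d s T (to_plant (tau_of s) *m z0)
    (fun t => to_plant (tau_of t) *m z (tau_of t)).
Proof.
move=> ST zsol.
pose G tau y := expR (- L tau) *: chain_field (phi alpha rho Tf Tc beta v) d (theta tau) y.
have ysol : filippov_solution G (tau_of s) S (to_plant (tau_of s) *m z0)
    (fun tau => to_plant tau *m z tau).
  apply: (filippov_solution_mulmx (M' := fun tau => (alpha * beta) *:
     (Dmx n rho *m scaling_mx n rho 1 (L tau) *m invmx Q)) _ _ _ zsol).
  - by move=> t _ _; split; [exact: to_plant_unit|exact: is_derive_to_plant].
  - by move=> b _ _; exact: to_plant_lipschitz.
  - move=> tau y _ _; have := aux_field_change_of_variables d tau (to_plant tau *m y).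
    rewrite mulmxA to_plantK mul1mx => ->.
    rewrite mulmxDr mulmxA to_auxK mul1mx -/(G tau _) -[LHS]addr0 -addrA.
    congr (_ + _).
    rewrite !mulmxA -mulmxDl.
    suff -> : to_plant tau *m
        (- alpha / beta *: (Q *m Dmx n rho *m scaling_mx n rho (-1) (L tau)))
        *m to_plant tau = - ((alpha * beta) *:
          (Dmx n rho *m scaling_mx n rho 1 (L tau) *m invmx Q)).
      by rewrite addNr mul0mx.
    have -> : to_plant tau *m
        (- alpha / beta *: (Q *m Dmx n rho *m scaling_mx n rho (-1) (L tau))) =
        - alpha *: Dmx n rho.
      rewrite /to_plant -scalemxAl -scalemxAr scalerA mulrC divfK ?gt_eqF//.
      rewrite -!mulmxA mulKmx ?Qmx_unit// mulmxA scaling_mx_D -mulmxA.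
      by rewrite scaling_mxK mulmx1.
    rewrite /to_plant -scalemxAl -scalemxAr scalerA mulNr scaleNr mulmxA.
    by [].
have xE : (fun t => to_plant (tau_of t) *m z (tau_of t)) =
    (fun tau => to_plant tau *m z tau) \o tau_of by [].
rewrite xE.
apply: (filippov_solution_time_change (c := fun t => expR (L (tau_of t)))
  _ _ _ _ ysol) => //.
- move=> t st tT; have [h1 h2] := ST _ st tT; split=> //.
  exact: is_derive_aux_time.
- move=> b sb bT; exists (expR (L (tau_of s))), (expR (L (tau_of b))).
  split; first exact: expR_gt0.
  have [h1 _] := ST _ sb bT.
  move=> t st tb; rewrite !ler_expR !lerD2l !ler_wpM2l//; apply: aux_time_le => //.
  by apply: lt_le_trans h1 _; rewrite lerD2l lerN2 ler_wpM2l// mulr_ge0// ltW.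
- move=> t y st tT; have [h1 _] := ST _ (ltW st) tT.
  by rewrite /G aux_timeK// scalerA -expRD subrr expR0 scale1r.
Qed.

(** Since [kappa = c0 * expR (alpha * tau)], the factor [kappa^(rho - n)]
    decays at the rate demanded of auxiliary disturbances, and [beta] absorbs
    the constant [c0^(rho - n)]. *)
Lemma aux_dist_admissible (Delta : R) d : 0 <= n%:R - rho ->
  expR (- (n%:R - rho) * ln c0) <= beta ->
  plant_disturbances Delta d -> aux_disturbances n Delta alpha rho (aux_dist d).
Proof.
move=> nr hb [md dD]; split.
  apply: measurable_funM.
    apply: measurable_funM; first exact: measurable_cst.
    apply: measurableT_comp => //; apply: measurable_funM => //.
    by apply: measurable_funD => //; exact: measurable_funM.
  apply: (@measurable_comp _ _ _ R R R (`[0, +oo[%classic : set R) d _ theta) => //.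
    move=> _ [t /= t0 <-]; move: t0; rewrite !in_itv/= !andbT => t0.
    by rewrite -(plant_time0 alpha c0) plant_time_le.
  apply: measurable_funTS; apply: continuous_measurable_fun => t.
  apply/differentiable_continuous/derivable1_diffP.
  by have [] := is_derive_plant_time alpha c00 t.
move=> tau tau0; have th0 : 0 <= theta tau.
  by rewrite -(plant_time0 alpha c0) plant_time_le.
have bV0 : 0 <= beta^-1 by rewrite invr_ge0 ltW.
rewrite /aux_dist !normrM (ger0_norm (expR_ge0 _)) (ger0_norm bV0).
have -> : - (n%:R - rho) * L tau =
    - (n%:R - rho) * ln c0 + - alpha * (n%:R - rho) * tau.
  by rewrite /log_kappa; ring.
rewrite expRD /=; set e1 := expR _ in hb *; set e2 := expR _.
have e20 : 0 <= e2 by exact: expR_ge0.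
have -> : beta^-1 * (e1 * e2) * `|d (theta tau)| =
    `|d (theta tau)| * (e1 / beta * e2) by ring.
rewrite ler_pM ?dD//; first by rewrite !mulr_ge0 ?invr_ge0 ?expR_ge0// ltW.
by rewrite ler_piMl// ler_pdivrMr// mul1r.
Qed.

End correspondence.

(** * The gain at the initial time *)

Section rates.
Context {R : realType} (n : nat).
Local Notation vec := 'cV[R]_n.

(** A continuous curve that starts away from the origin cannot tend to the
    origin at arbitrarily small times. *)
Lemma admissible_settling_gt0 (Delta alpha rho : R) (Tf : \bar R) (v : vec -> R) :
  (0 < n)%N -> 0 <= Delta -> admissible_aux_controller Delta alpha rho Tf v ->
  (0 < Tf)%E.
Proof.
move=> n0 D0 [ex _ sT _]; rewrite ltNge; apply/negP => Tf0.
pose z0 : vec := const_mx 1.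
have z01 : 1 <= `|z0|.
  by have := mx_entry_norm z0 (Ordinal n0) ord0; rewrite mxE normr1.
have adm0 : aux_disturbances n Delta alpha rho (fun=> 0).
  split; first exact: measurable_cst.
  by move=> t _ /=; rewrite normr0 mulr_ge0// expR_ge0.
have [z zsol] := ex _ z0 adm0; have [zs acz _] := zsol.
have half0 : 0 < 1 / 2 :> R by lra.
have [d d0 dP] := abs_continuous_dist half0 (acz 1 ler01 (ltry _)).
have d10 : 0 < Num.min d 1 by rewrite lt_min d0/=.
have : (settling_time Delta alpha rho v z0 < (Num.min d 1)%:E)%E.
  apply: (@le_lt_trans _ _ 0%E); last by rewrite lte_fin.
  by apply: le_trans (le_trans sT Tf0); apply: ereal_sup_ubound; exists z0.
move=> /ereal_inf_lt[_ [xi [xi0 xiP] <-]]; rewrite lte_fin lt_min => /andP[xid xi1].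
have := xiP _ z adm0 zsol.
move=> /cvgrPdist_lt/(_ _ half0).
move=> /nbhs_ballP[r/= r0 rP].
(* A time just after [xi], close enough for both limits to apply. *)
pose g := Num.min r (Num.min (d - xi) (1 - xi)).
have g0 : 0 < g by rewrite !lt_min r0 !subr_gt0 xid.
have gr : g <= r by rewrite ge_min lexx.
have gd : g <= d - xi by rewrite !ge_min lexx orbT.
have g1 : g <= 1 - xi by rewrite !ge_min lexx !orbT.
have b1 : `|0 - z (xi + g / 2)| < 1 / 2.
  apply: rP; last by rewrite /=; lra.
  - rewrite /ball/= opprD addrA subrr sub0r normrN ger0_norm; lra.
  - by apply/eqP; lra.
have b2 : `|z (xi + g / 2) - z 0| < 1 / 2 by apply: dP; lra.
move: b1 b2; rewrite sub0r normrN zs => b1 b2.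
have := ler_normB (z (xi + g / 2)) (z (xi + g / 2) - z0).
rewrite opprB addrC subrK; lra.
Qed.

Definition initial_kappa (alpha Tc : R) (Tf : \bar R) : R :=
  (alpha_over_eta alpha Tf * Tc)^-1.

(** The constant [c0], which is kappa at time [0], absorbs [Tf], so the cases
    [alpha = 0] and [Tf = +oo] need no separate treatment afterwards. *)
Lemma initial_kappaP (alpha Tc : R) (Tf : \bar R) : 0 <= alpha ->
  (Tf = +oo%E -> 0 < alpha) -> (0 < Tf)%E -> 0 < Tc ->
  let c0 := initial_kappa alpha Tc Tf in
  [/\ 0 < c0, forall t, kappa alpha Tf Tc t = c0 / (1 - alpha * c0 * t) &
      alpha * c0 * Tc <= 1].
Proof.
move=> a0 aTf Tf0 Tc0; rewrite /initial_kappa /alpha_over_eta /kappa.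
have [alpha0|alphan0] := eqVneq alpha 0.
  have fT0 : 0 < fine Tf.
    case: Tf aTf Tf0 => [r|h|]//=.
    by move: (h erefl); rewrite alpha0 ltxx.
  rewrite alpha0 !mul0r; split=> //.
    by rewrite invr_gt0 mulr_gt0// invr_gt0.
  by move=> t; rewrite !mul0r subr0 divr1 invfM invrK.
have alpha0 : 0 < alpha by rewrite lt_neqAle eq_sym alphan0.
have [eta0 eta1] : 0 < Defs.eta alpha Tf /\ Defs.eta alpha Tf <= 1.
  rewrite /Defs.eta; case: Tf {aTf} Tf0 => [r| |]//=.
    move=> r0; rewrite subr_gt0 expR_lt1 oppr_lt0 mulr_gt0//.
  by move=> _; rewrite gt0_muley ?lte_fin//= subr0 ltr01.
have -> : (alpha / Defs.eta alpha Tf * Tc)^-1 = alpha^-1 * Defs.eta alpha Tf / Tc.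
  by rewrite !invfM invrK.
split.
- by rewrite !mulr_gt0// invr_gt0.
- move=> t.
  have -> : 1 - alpha * (alpha^-1 * Defs.eta alpha Tf / Tc) * t =
      (Tc - Defs.eta alpha Tf * t) / Tc.
    by field; rewrite alphan0 gt_eqF.
  rewrite !invfM invrK; set Y := (Tc - _)^-1; field.
  by rewrite alphan0 gt_eqF.
- have -> // : alpha * (alpha^-1 * Defs.eta alpha Tf / Tc) * Tc =
      Defs.eta alpha Tf.
  by field; rewrite alphan0 gt_eqF.
Qed.
End rates.

(** * Stability when the gain stays bounded *)

Section stable.
Context {R : realType} (n : nat).
Local Notation vec := 'cV[R]_n.
Variables (Delta alpha rho : R) (Tf : \bar R) (Tc beta c0 : R) (v w : vec -> R).
Hypotheses (n0 : (0 < n)%N) (alpha0 : 0 <= alpha) (c00 : 0 < c0) (beta0 : 0 < beta).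
Hypotheses (Tc0 : 0 < Tc) (rho_n : rho <= n%:R).
Hypothesis kappaE : forall t, kappa alpha Tf Tc t = c0 / (1 - alpha * c0 * t).
Hypothesis beta_ge : expR (- (n%:R - rho) * ln c0) <= beta.
Local Notation u := (hybrid_controller alpha rho Tf Tc beta v w).
Local Notation ph := (phi alpha rho Tf Tc beta v).

Lemma hybrid_phi d t (x : vec) : 0 <= t -> t < Tc ->
  chain_field u d t x = chain_field ph d t x.
Proof. by move=> t0 tT; rewrite /chain_field /hybrid_controller t0 tT. Qed.

Lemma hybrid_w d t (x : vec) : Tc <= t ->
  chain_field u d t x = chain_field (fun x _ => w x) d t x.
Proof.
by move=> Tt; rewrite /chain_field /hybrid_controller [t < Tc]ltNge Tt andbF.
Qed.

Lemma chain_solution_phi d s (T : \bar R) (x0 : vec) x : 0 <= s -> (T <= Tc%:E)%E ->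
  chain_solution u d s T x0 x <-> chain_solution ph d s T x0 x.
Proof.
move=> s0 TT; split; apply: filippov_solution_congr => t y st tT;
  by rewrite hybrid_phi ?(le_trans s0) ?ltW// -lte_fin (lt_le_trans tT).
Qed.

Lemma chain_solution_w d s (T : \bar R) (x0 : vec) x : Tc <= s ->
  chain_solution u d s T x0 x <-> chain_solution (fun x _ => w x) d s T x0 x.
Proof.
move=> Ts; split; apply: filippov_solution_congr => t y st tT;
  by rewrite hybrid_w// (le_trans Ts)// ltW.
Qed.

Lemma abs_continuous_norm_le s b (x : R -> vec) (e : R) : s < b ->
  abs_continuous s b x -> (forall t, s <= t -> t < b -> `|x t| <= e) ->
  `|x b| <= e.
Proof.
move=> sb acx xe; apply/ler_addgt0Pr => e' e'0.
have [d d0 dP] := abs_continuous_dist e'0 acx.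
pose t := Num.max s (b - d / 2).
have st : s <= t by rewrite le_max lexx.
have tb : t < b by rewrite gt_max sb/=; lra.
have td : b - d / 2 <= t by rewrite le_max lexx orbT.
have h1 := xe _ st tb.
have h2 : `|x b - x t| < e' by apply: dP => //; [exact: ltW|lra].
have := ler_normD (x t) (x b - x t); rewrite addrC subrK; lra.
Qed.

Lemma lipschitz_bounded m (M : R -> 'M[R]_m) (b : R) :
  (exists2 k, 0 <= k & forall p q, 0 <= p -> p <= q -> q <= b ->
    `|M q - M p| <= k * (q - p)) ->
  exists2 C, 0 <= C & forall t, 0 <= t -> t <= b -> `|M t| <= C.
Proof.
move=> [k k0 kP]; exists (`|M 0| + k * `|b|); first by rewrite addr_ge0// mulr_ge0.
move=> t t0 tb; rewrite -(subrK (M 0) (M t)) (le_trans (ler_normD _ _))//.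
rewrite addrC lerD2l (le_trans (kP _ _ _ _ _))// ler_wpM2l// subr0.
by rewrite (le_trans tb)// ler_norm.
Qed.

Lemma hybrid_stable : alpha * c0 * Tc < 1 ->
  uniformly_lyapunov_stable (aux_disturbances n Delta alpha rho) (fun z _ => v z) ->
  uniformly_lyapunov_stable (plant_disturbances Delta) (fun x _ => w x) ->
  uniformly_lyapunov_stable (plant_disturbances Delta) u.
Proof.
move=> cT vstable wstable e e0; have [dw dw0 wP] := wstable _ e0.
pose tau := aux_time alpha c0.
have ac0 : 0 <= alpha * c0 by rewrite mulr_ge0// ltW.
have den t : t <= Tc -> 0 < 1 - alpha * c0 * t.
  move=> tT; rewrite subr_gt0; apply: le_lt_trans cT; exact: ler_wpM2l.
have [C C0 CP] := lipschitz_bounded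
  (to_plant_lipschitz n rho beta c0 alpha0 0 (tau Tc)).
have [C' C'0 C'P] := lipschitz_bounded
  (to_aux_lipschitz n rho beta c0 alpha0 0 (tau Tc)).
pose e1 := Num.min e dw; have e10 : 0 < e1 by rewrite lt_min e0.
have nC0 : 0 < n%:R * C + 1 by rewrite ltr_wpDl// mulr_ge0.
have nC'0 : 0 < n%:R * C' + 1 by rewrite ltr_wpDl// mulr_ge0.
have [dz dz0 zP] := vstable _ (divr_gt0 e10 nC0).
exists (Num.min dw (dz / (n%:R * C' + 1))); first by rewrite lt_min dw0 divr_gt0.
move=> s d x0 s0 dD; rewrite le_min => /andP[x0dw x0dz].
have [Ts|sT] := leP Tc s.
  have [[x xsol] xb] := wP s d x0 s0 dD x0dw; split.
    by exists x; apply/chain_solution_w.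
  by move=> T y /(chain_solution_w _ _ _ _ Ts); exact: xb.
have tau_ge0 t : 0 <= t -> t <= Tc -> 0 <= tau t.
  move=> t0 tT; rewrite -(aux_time0 alpha c00).
  by apply: aux_time_le => //; exact: den.
have tau_le t : t <= Tc -> tau t <= tau Tc.
  by move=> tT; apply: aux_time_le => //; exact: den.
have sd : 0 < 1 - alpha * c0 * s by exact: den (ltW sT).
have pi_adm : aux_disturbances n Delta alpha rho (aux_dist n alpha rho beta c0 d).
  by apply: aux_dist_admissible dD => //; rewrite subr_ge0.
pose z0 := to_aux n alpha rho beta c0 (tau s) *m x0.
have z0dz : `|z0| <= dz.
  apply: le_trans (mulmx_norm_le _ _) _.
  apply: (@le_trans _ _ ((n%:R * C' + 1) * `|x0|)); last first.
    by rewrite mulrC -ler_pdivlMr.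
  rewrite ler_wpM2r// ler_wpDr// ler_wpM2l// C'P ?tau_ge0 ?tau_le//; exact: ltW.
have [[z zsol] zb] := zP _ _ z0 (tau_ge0 _ s0 (ltW sT)) pi_adm z0dz.
have thtau t : t <= Tc -> plant_time alpha c0 (tau t) = t.
  by move=> tT; rewrite aux_timeK// den.
have before (T : \bar R) x t : chain_solution u d s T x0 x ->
    s <= t -> (t%:E < T)%E -> t < Tc -> `|x t| <= e1.
  move=> xsol st tT tTc.
  have [t1 [tt1 t1T t1Tc]] : exists t1, [/\ t < t1, (t1%:E <= T)%E & t1 <= Tc].
    case: T tT {xsol} => [T| |]// tT.
      exists (Num.min T Tc); rewrite lee_fin lt_min -lte_fin tT tTc.
      by rewrite !ge_min !lexx orbT.
    by exists Tc; rewrite leey.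
  have t1sol : chain_solution ph d s t1%:E x0 x.
    have t1Tc' : (t1%:E <= Tc%:E)%E by rewrite lee_fin.
    apply: (chain_solution_phi _ _ _ s0 t1Tc').1.
    rewrite -(_ : x s = x0); last by case: xsol.
    apply: filippov_solution_restrict xsol => //.
    by apply: le_lt_trans tT; rewrite lee_fin.
  have zsol' : chain_solution (fun z _ => v z) (aux_dist n alpha rho beta c0 d)
      (tau s) (tau t1)%:E z0
      (fun a => to_aux n alpha rho beta c0 a *m x (plant_time alpha c0 a)).
    apply: (plant_to_aux n0 alpha0 c00 beta0 kappaE (T := t1%:E)); last first.
      by rewrite thtau// ltW.
    move=> a _; rewrite !lte_fin => at1.
    by rewrite -(thtau t1)//; exact: plant_time_lt.
  have tau_st : tau s <= tau t by apply: aux_time_le => //; exact: den (ltW tTc).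
  have tau_tt1 : ((tau t)%:E < (tau t1)%:E)%E.
    by rewrite lte_fin; apply: aux_time_lt => //; exact: den.
  have := zb _ _ zsol' (tau t) tau_st tau_tt1; rewrite thtau ?(ltW tTc)//.
  set y := _ *m x t => yb.
  have -> : x t = to_plant n alpha rho beta c0 (tau t) *m y.
    by rewrite /y mulmxA to_auxK// mul1mx.
  apply: le_trans (mulmx_norm_le _ _) _.
  apply: (@le_trans _ _ ((n%:R * C + 1) * `|y|)).
    rewrite ler_wpM2r// ler_wpDr// ler_wpM2l// CP ?tau_ge0 ?tau_le// ?(ltW tTc)//.
    exact: le_trans st.
  by rewrite mulrC -ler_pdivlMr.
have e1e : e1 <= e by rewrite ge_min lexx.
have e1dw : e1 <= dw by rewrite ge_min lexx orbT.
split; last first.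
  move=> T x xsol t st tT.
  have [tTc|Tct] := ltP t Tc.
    exact: le_trans (before _ _ _ xsol st tT tTc) e1e.
  have TcT : (Tc%:E < T)%E by apply: le_lt_trans tT; rewrite lee_fin.
  have xTc : `|x Tc| <= e1.
    case: (xsol) => _ acx _.
    apply: (abs_continuous_norm_le sT (acx _ (ltW sT) TcT)).
    move=> r sr rT; apply: (before _ _ _ xsol sr _ rT).
    by apply: lt_trans TcT; rewrite lte_fin.
  have wsol : chain_solution (fun x _ => w x) d Tc T (x Tc) x.
    apply: (chain_solution_w _ _ _ _ (lexx Tc)).1.
    exact: (filippov_solution_restrict (ltW sT) TcT (lexx T) xsol).
  have [_ wb] := wP Tc d (x Tc) (ltW Tc0) dD (le_trans xTc e1dw).
  exact: wb wsol _ Tct tT.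
(* The plant time exceeds [Tc] slightly while kappa is still finite, so that
   the transported solution is absolutely continuous up to [Tc] included. *)
pose b := Tc + (1 - alpha * c0 * Tc) / (2 * (alpha * c0 + 1)).
have g0 : 0 < 1 - alpha * c0 * Tc by exact: den.
have Tcb : Tc < b by rewrite ltrDl divr_gt0// mulr_gt0// ltr_wpDl.
have denb : 0 < 1 - alpha * c0 * b.
  have -> : 1 - alpha * c0 * b = (1 - alpha * c0 * Tc) *
      ((alpha * c0 + 2) / (2 * (alpha * c0 + 1))).
    by rewrite /b; field; apply/eqP; lra.
  by rewrite mulr_gt0// divr_gt0 ?mulr_gt0//; lra.
have x1sol : chain_solution ph d s b%:E x0
    (fun t => to_plant n alpha rho beta c0 (tau t) *m z (tau t)).
  rewrite -[x0]mul1mx -(to_auxK n alpha rho c0 beta0 (tau s)) -mulmxA.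
  apply: (aux_to_plant n0 alpha0 c00 beta0 kappaE _ zsol) => t st.
  rewrite lte_fin => tb; split; last exact: ltry.
  by apply: lt_le_trans denb _; rewrite lerD2l lerN2 ler_wpM2l// ltW.
move: x1sol; set x1 := fun t => _ => x1sol.
have acx1 : abs_continuous s Tc x1.
  by case: x1sol => _ + _; apply; [exact: ltW|rewrite lte_fin].
have x1sol' : chain_solution u d s Tc%:E x0 x1.
  apply: (chain_solution_phi _ _ _ s0 (lexx Tc%:E)).2.
  rewrite -(_ : x1 s = x0); last by case: x1sol.
  by apply: filippov_solution_restrict x1sol => //;
    rewrite ?lte_fin ?lee_fin ?(lt_trans sT)// ltW.
have x1Tc : `|x1 Tc| <= e1.
  apply: (abs_continuous_norm_le sT acx1) => t st tT.
  by apply: (before _ _ _ x1sol' st _ tT); rewrite lte_fin.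
have [[x2 x2sol] _] := wP Tc d (x1 Tc) (ltW Tc0) dD (le_trans x1Tc e1dw).
exists (fun t => if t < Tc then x1 t else x2 t).
apply: (filippov_solution_glue (ltW sT) acx1 x1sol').
exact: (chain_solution_w _ _ _ _ (lexx Tc)).2.
Qed.

End stable.

(** * Instability when the gain blows up *)

Section unstable.
Context {R : realType} (n : nat).
Local Notation vec := 'cV[R]_n.

(** Coordinate [i.+1] is the velocity of coordinate [i].  The control does not
    act on coordinate [i], so this survives the Filippov convexification. *)
Lemma chain_coord_increment_le (u : vec -> R -> R) (d : R -> R) (s : R)
    (T : \bar R) (x0 : vec) x
    (i j : 'I_n) (e b : R) : i.+1 = j :> nat -> 0 <= e ->
  chain_solution u d s T x0 x -> s <= b -> (b%:E < T)%E ->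
  (forall t, s <= t -> t <= b -> `|x t j ord0| <= e) ->
  `|x b i ord0 - x s i ord0| <= e * (b - s).
Proof.
move=> ij e0 [xs acx aex] sb bT xe.
pose P : 'rV[R]_n := delta_mx ord0 i.
have PE (y : vec) : P *m y = (y i ord0)%:M.
  by rewrite -rowE; apply/matrixP => k l; rewrite !ord1 !mxE eqxx mulr1n.
have acP : abs_continuous s b (fun t => P *m x t).
  apply: (@abs_continuous_mulmx _ _ _ s b 0 (fun=> P) x) => //; last exact: acx.
  by move=> p q _ _ _; rewrite subrr normr0 mul0r.
have PJ (y : vec) : P *m (Jmx n *m y) = (y j ord0)%:M.
  rewrite PE; congr (_%:M); rewrite mxE (bigD1 j)//= big1 => [|k kj].
    by rewrite mxE ij eqxx mul1r addr0.
  rewrite mxE ij (_ : (k == j :> nat) = false) ?mul0r//.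
  by apply/negbTE.
have Pb : P *m (bvec n n : vec) = 0.
  rewrite PE; apply/matrixP => k l; rewrite !mxE (_ : (i.+1 == n) = false) ?mul0rn//.
  by rewrite ij ltn_eqF.
have := abs_continuous_lipschitz e0 sb acP _.
rewrite !PE -raddfB/= norm_scalar_mx1; apply; apply: filterS aex => t h st tb.
have [|y fy xy] := h st; first by apply: lt_trans bT; rewrite lte_fin.
exists (P *m y); last first.
  have := is_derive_mulmx (@is_derive_cst _ _ _ P t 1) xy.
  by rewrite mul0mx addr0.
have n0 : (0 < n)%N by exact: leq_ltn_trans (ltn_ord i).
have fE (z : vec) : P *m chain_field u d t z = P *m Jmx n *m z.
  by rewrite /chain_field mulmxDr -scalemxAr Pb scaler0 addr0 mulmxA.
have -> := filippov_set_coord n0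
  (@mulmx_continuous _ _ _ (P *m Jmx n) (x t)) fE fy.
by rewrite -mulmxA PJ norm_scalar_mx1 xe// ltW.
Qed.

(** The first row of [Q] is the first basis row. *)
Lemma to_aux_first_coord (alpha rho beta c0 tau : R) (y : vec) (i : 'I_n) :
  i = 0 :> nat ->
  (to_aux n alpha rho beta c0 tau *m y) i ord0 =
  beta^-1 * expR (rho * log_kappa alpha c0 tau) * y i ord0.
Proof.
move=> i0; rewrite /to_aux -scalemxAl mxE -mulmxA -mulrA; congr (_ * _).
rewrite mxE (bigD1 i)//= big1 => [|k ki].
  rewrite Qmx_entry krylov_entry// eqxx mul1r addr0 mul_diag_mx !mxE i0.
  by congr (expR _ * _); ring.
rewrite Qmx_entry krylov_entry; last by rewrite i0.
by rewrite (_ : (i == k :> nat) = false) ?mul0r//; apply/negbTE; rewrite eq_sym.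
Qed.

Lemma hybrid_unstable (Delta alpha rho : R) (Tf : \bar R) (Tc beta c0 : R)
    (v w : vec -> R) :
  (1 < n)%N -> 0 <= Delta -> 0 <= alpha -> 0 < c0 -> 0 < beta -> 0 < Tc ->
  (forall t, kappa alpha Tf Tc t = c0 / (1 - alpha * c0 * t)) ->
  alpha * c0 * Tc = 1 ->
  admissible_aux_controller Delta alpha rho Tf v ->
  ~ uniformly_lyapunov_stable (plant_disturbances Delta)
      (hybrid_controller alpha rho Tf Tc beta v w).
Proof.
move=> n1 D0 alpha0 c00 beta0 Tc0 kappaE cT [_ _ _ zlim] stable.
have n0 : (0 < n)%N by exact: ltnW.
have [del del0 stableP] := stable 1 ltr01.
pose i0 := Ordinal n0; pose i1 := Ordinal n1.
(* With [Tc - s <= del / 2] and unit speed the first coordinate cannot fall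
   below [del / 2] before [Tc]. *)
pose g := Num.min Tc (del / 2).
have g0 : 0 < g by rewrite lt_min Tc0 divr_gt0.
have gT : g <= Tc by rewrite ge_min lexx.
have gd : g <= del / 2 by rewrite ge_min lexx orbT.
pose s := Tc - g.
have s0 : 0 <= s by rewrite subr_ge0.
have sT : s < Tc by rewrite /s; lra.
have ac0 : 0 < alpha * c0.
  by rewrite -(pmulr_lgt0 _ Tc0) cT.
have den t : t < Tc -> 0 < 1 - alpha * c0 * t.
  by move=> tT; rewrite subr_gt0 -cT ltr_pM2l.
pose x0 : vec := del *: bvec n 1.
have x0d : `|x0| <= del.
  apply: mx_norm_leP => [|i j]; first exact: ltW.
  by rewrite !mxE; case: eqP => _; rewrite ?mulr1 ?mulr0 ?normr0 ?gtr0_norm// ltW.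
have d0 : plant_disturbances Delta (fun=> 0 : R).
  by split; [exact: measurable_cst|move=> t _; rewrite normr0].
have [[x xsol] xb] := stableP s _ x0 s0 d0 x0d.
have xs : x s = x0 by case: xsol.
have x1 t : s <= t -> `|x t| <= 1 by move=> st; apply: xb xsol _ st _; exact: ltry.
pose sigma := aux_time alpha c0 s.
have thsigma : plant_time alpha c0 sigma = s by rewrite aux_timeK// den.
have thT tau : plant_time alpha c0 tau < Tc.
  by rewrite -(ltr_pM2l ac0) cT -subr_gt0 plant_time_denom// expR_gt0.
have phisol : chain_solution (phi alpha rho Tf Tc beta v) (fun=> 0) s Tc%:E x0 x.
  apply: (chain_solution_phi _ _ _ _ _ w _ _ _ s0 (lexx Tc%:E)).1; rewrite -xs.
  by apply: filippov_solution_restrict xsol => //; rewrite ?ltry ?leey.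
pose z tau := to_aux n alpha rho beta c0 tau *m x (plant_time alpha c0 tau).
have zsol : chain_solution (fun z _ => v z) (aux_dist n alpha rho beta c0 (fun=> 0))
    sigma +oo%E (to_aux n alpha rho beta c0 sigma *m x0) z.
  apply: (plant_to_aux n0 alpha0 c00 beta0 kappaE (T := Tc%:E)).
    by move=> tau _ _; rewrite lte_fin.
  by rewrite thsigma.
(* Admissibility speaks of solutions from time [0]; without disturbance the
   auxiliary system is autonomous, so the solution can be shifted. *)
have zsol' : aux_solution v (fun=> 0) (to_aux n alpha rho beta c0 sigma *m x0)
    (z \o (fun t => t + sigma)).
  apply: (filippov_solution_time_change (c := fun=> 1) _ _ _ _ zsol).
  - exact: add0r.
  - move=> t _ _; split; first exact: ltry.
    by rewrite -[X in is_derive _ _ _ X]addr0; exact: is_deriveD.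
  - by move=> b _ _; exists 1, 1; rewrite ltr01; split=> // t _ _; rewrite lexx.
  - by move=> t y _ _; rewrite scale1r /chain_field /aux_dist mulr0.
have adm0 : aux_disturbances n Delta alpha rho (fun=> 0).
  split; first exact: measurable_cst.
  by move=> t _ /=; rewrite normr0 mulr_ge0// expR_ge0.
have := zlim _ _ _ adm0 zsol' i0.
(* By clause (ii), [C] times the first plant coordinate tends to [0]: the
   weight [expR (- alpha * rho * t)] cancels the growth of [kappa^rho]. *)
pose C := beta^-1 * expR (rho * (ln c0 + alpha * sigma)).
have C0 : 0 < C by rewrite mulr_gt0 ?invr_gt0 ?expR_gt0.
move=> /cvgrPdist_lt/(_ (C * (del / 2)))[|t0 [_ t0P]].
  by rewrite mulr_gt0// divr_gt0.
have tt0 : t0 < Num.max t0 0 + 1.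
  by rewrite (@le_lt_trans _ _ (Num.max t0 0)) ?le_max ?lexx ?ltrDl.
have t00 : 0 <= Num.max t0 0 + 1 by rewrite addr_ge0// le_max lexx orbT.
have := t0P _ tt0; set t := Num.max t0 0 + 1 in t00 *.
rewrite /= to_aux_first_coord// sub0r normrN.
set y := x _ _ _.
have -> : expR (- alpha * (rho + 1 - 1) * t) *
    (beta^-1 * expR (rho * log_kappa alpha c0 (t + sigma)) * y) = C * y.
  rewrite mulrA mulrCA -expRD /C; congr (_ * expR _ * _).
  by rewrite /log_kappa; ring.
rewrite normrM gtr0_norm// ltr_pM2l// => ysmall.
have sth : s <= plant_time alpha c0 (t + sigma).
  by rewrite -[s in leLHS]thsigma plant_time_le// lerDr.
have := @chain_coord_increment_le _ _ _ _ _ _ i0 i1 1 _ erefl ler01 phisol sth _ _.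
rewrite lte_fin thT => /(_ isT); rewrite -/y mul1r xs.
have -> : x0 i0 ord0 = del by rewrite !mxE eqxx mulr1.
have h t' : s <= t' -> t' <= plant_time alpha c0 (t + sigma) ->
    `|x t' i1 ord0| <= 1.
  by move=> st' _; apply: le_trans (mx_entry_norm _ _ _) (x1 _ st').
move=> /(_ h); have := thT (t + sigma); move: ysmall.
rewrite ltr_norml ler_norml => /andP[_ y1] th /andP[y2 _].
by rewrite /s in y2; lra.
Qed.

End unstable.

(** * The equivalence *)

Theorem proposition3 (R : realType) (n : nat) (Delta alpha rho : R)
    (Tf : \bar R) (Tc beta : R) (v w : 'cV[R]_n -> R)
    (hn : (1 < n)%N)
    (hDelta : 0 <= Delta)
    (hrho0 : 0 <= rho) (hrho : rho < n%:R - 1)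
    (halpha : 0 <= alpha)
    (hTf : (0 <= Tf)%E) (halphaTf : Tf = +oo%E -> 0 < alpha)
    (hv : admissible_aux_controller Delta alpha rho Tf v)
    (hvstable : uniformly_lyapunov_stable
                  (aux_disturbances n Delta alpha rho) (fun z _ => v z))
    (hw : robust_controller Delta w)
    (hTc : 0 < Tc)
    (hbeta : (alpha_over_eta alpha Tf * Tc) `^ (n%:R - rho) <= beta) :
  uniformly_lyapunov_stable (plant_disturbances Delta)
    (hybrid_controller alpha rho Tf Tc beta v w)
  <->
  exists M : R, forall t : R, 0 <= t < Tc -> `|kappa alpha Tf Tc t| <= M.
Proof.
have n0 : (0 < n)%N by exact: ltnW.
have Tf0 := admissible_settling_gt0 n0 hDelta hv.
have := initial_kappaP halpha halphaTf Tf0 hTc.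
set c0 := initial_kappa _ _ _ => -[c00 kappaE cT].
have beta_ge : expR (- (n%:R - rho) * ln c0) <= beta.
  move: hbeta; have -> : alpha_over_eta alpha Tf * Tc = c0^-1 by rewrite /c0 invrK.
  rewrite /powR invr_eq0 gt_eqF// lnV ?posrE//.
  by have -> : (n%:R - rho) * - ln c0 = - (n%:R - rho) * ln c0 by ring.
have beta0 : 0 < beta by apply: lt_le_trans beta_ge; exact: expR_gt0.
move: cT; rewrite le_eqVlt => /orP[/eqP cT|cT]; last first.
  split=> [_|_]; last first.
    apply: (hybrid_stable n0 halpha c00 beta0 hTc _ kappaE beta_ge cT hvstable hw.2).
    by lra.
  exists (c0 / (1 - alpha * c0 * Tc)) => t /andP[t0 tT].
  have h : 1 - alpha * c0 * Tc <= 1 - alpha * c0 * t.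
    by rewrite lerD2l lerN2 ler_wpM2l ?(ltW tT)// mulr_ge0// ltW.
  rewrite kappaE ger0_norm; last by rewrite divr_ge0 ?(ltW c00)//; lra.
  by rewrite ler_wpM2l ?(ltW c00)// lef_pV2// posrE; lra.
split; first by move=> /(hybrid_unstable hn hDelta halpha c00 beta0 hTc kappaE cT hv).
move=> [M Mb]; exfalso.
have M0 : 0 <= M by apply: le_trans (Mb 0 _); rewrite ?lexx.
(* At this time kappa equals [c0 + M + 1]. *)
pose t := Tc * (1 - c0 / (c0 + M + 1)).
have cM : 0 < c0 + M + 1 by lra.
have q0 : 0 < c0 / (c0 + M + 1) by rewrite divr_gt0.
have q1 : c0 / (c0 + M + 1) < 1 by rewrite ltr_pdivrMr//; lra.
have tI : 0 <= t < Tc.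
  rewrite mulr_ge0 ?subr_ge0 ?(ltW hTc) ?(ltW q1)//=.
  by rewrite gtr_pMr// ltrBlDr ltrDl.
have kappa_t : kappa alpha Tf Tc t = c0 + M + 1.
  rewrite kappaE /t mulrA cT mul1r subKr; field.
  by rewrite !gt_eqF.
have := Mb _ tI; rewrite kappa_t ger0_norm ?(ltW cM)//; lra.
Qed.
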